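(* Let $\varphi$ be an analytic self-map of $\mathbb{D}$ and let $B$ be a finite Blaschke product. Then $C_\varphi: BH^\infty\to BH^\infty$ is an automorphism of $BH^\infty$ if and only if $\varphi\in\mathrm{Aut}(\mathbb{D})$ and $mult_B(\varphi(w))=mult_B(w)$ for all $w\in Z(B)$.
   Context: $\mathbb{D}$ is the open unit disc in $\mathbb{C}$; $\mathrm{Aut}(\mathbb{D})$ is the set of bijective analytic self-maps of $\mathbb{D}$; $H^\infty$ is the algebra of bounded analytic functions on $\mathbb{D}$ with pointwise operations; $BH^\infty=\{Bf: f\in H^\infty\}$. $C_\varphi f=f\circ\varphi$. An automorphism of a (not necessarily unital) algebra is a bijective, linear, multiplicative self-map of it; the statement ''$C_\varphi:BH^\infty\to BH^\infty$ is an automorphism'' includes that $C_\varphi$ maps $BH^\infty$ into itself. A finite Blaschke product is a unimodular constant times a finite product of factors $\frac{a-z}{1-\bar a z}$ with $a\in\mathbb{D}$. For an analytic function $f\not\equiv0$ on $\mathbb{D}$, $Z(f)$ is its set of zeros in $\mathbb{D}$, and $mult_f(w)$ is the order of vanishing of $f$ at $w$ (equal to $0$ if $f(w)\neq 0$). *)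

(* Defs.v *)
From Stdlib Require Import Reals List ClassicalEpsilon.
From Stdlib Require Import ssreflect ssrfun.
From Coquelicot Require Import Coquelicot.

Open Scope C_scope.

(* Functions on the disc have the subtype [unit_disc] as their domain, so that no
   values outside the disc are involved and equality of functions is equality
   on the disc. *)
Definition unit_disc : Type := {z : C | (Cmod z < 1)%R}.

Definition disc_val (z : unit_disc) : C := proj1_sig z.
Coercion disc_val : unit_disc >-> C.

(* [f] is, near [w], the sum of the convergent power series
   [\sum_k a k * (z - w) ^ k]. *)
Definition power_series_at (f : unit_disc -> C) (w : unit_disc) (a : nat -> C) : Prop :=
  exists r : R, (0 < r)%R /\
    forall z : unit_disc, (Cmod (z - w) < r)%R ->
      @is_pseries C_AbsRing C_NormedModule a (z - w) (f z).

Definition analytic (f : unit_disc -> C) : Prop :=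
  forall w : unit_disc, exists a : nat -> C, power_series_at f w a.

Definition bounded_fun (f : unit_disc -> C) : Prop :=
  exists M : R, forall z : unit_disc, (Cmod (f z) <= M)%R.

Definition Hinf (f : unit_disc -> C) : Prop := analytic f /\ bounded_fun f.

Definition BHinf (B : unit_disc -> C) (g : unit_disc -> C) : Prop :=
  exists f : unit_disc -> C, Hinf f /\ g = (fun z => B z * f z).

Definition analytic_self_map (phi : unit_disc -> unit_disc) : Prop :=
  analytic (fun z => phi z : C).

Definition Aut_disc (phi : unit_disc -> unit_disc) : Prop :=
  analytic_self_map phi /\ bijective phi.

Definition comp_op (phi : unit_disc -> unit_disc) (f : unit_disc -> C) : unit_disc -> C :=
  fun z => f (phi z).

(* [T] restricts to an automorphism of the algebra of functions satisfying [A],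
   which need not contain the constants; [T] is defined on all functions, but
   only its values on [A] matter. *)
Definition algebra_automorphism
    (A : (unit_disc -> C) -> Prop) (T : (unit_disc -> C) -> (unit_disc -> C)) : Prop :=
  (forall f, A f -> A (T f)) /\
  (forall f g, A f -> A g -> T (fun z => f z + g z) = (fun z => T f z + T g z)) /\
  (forall (c : C) f, A f -> T (fun z => c * f z) = (fun z => c * T f z)) /\
  (forall f g, A f -> A g -> T (fun z => f z * g z) = (fun z => T f z * T g z)) /\
  (forall f g, A f -> A g -> T f = T g -> f = g) /\
  (forall g, A g -> exists f, A f /\ T f = g).

Definition blaschke_factor (a z : unit_disc) : C := (a - z) / (1 - Cconj a * z).

(* The list may be empty (unimodular constants are finite Blaschke products)
   and may have repetitions. *)
Definition finite_blaschke_product (B : unit_disc -> C) : Prop :=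
  exists (c : C) (l : list unit_disc), Cmod c = 1%R /\
    forall z : unit_disc,
      B z = c * fold_right (fun a p => blaschke_factor a z * p) 1 l.

Definition zero_set (f : unit_disc -> C) (w : unit_disc) : Prop := f w = 0.

Definition vanishing_order (f : unit_disc -> C) (w : unit_disc) (n : nat) : Prop :=
  exists a : nat -> C, power_series_at f w a /\
    (forall k : nat, (k < n)%nat -> a k = 0) /\ a n <> 0.

(* The order of vanishing exists and is unique when [f] is analytic and not
   identically zero; for other [f] the value of [multiplicity] is irrelevant. *)
Definition multiplicity (f : unit_disc -> C) (w : unit_disc) : nat :=
  epsilon (inhabits 0%nat) (vanishing_order f w).

(* Main.v *)
(* If [phi] induces an automorphism, let [G] and [H] be the preimages of [B] and
   [z B]. Then [H / G] inverts [phi] wherever [G <> 0]: it takes no value [c]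
   outside the closed disc, since the preimage [L] of [B / (z - c)] would satisfy
   [(H - c G) L = G ^ 2], and if it takes the value [b] in the disc at [w], then
   composing with [phi] gives [(z - phi b) G ^ 2 = (H - b G) K] for some [K], so
   [phi b = w].  Near a zero of [G] the bounded quotient extends, with a value
   inside the disc by the maximum principle, so [phi] is onto.  Comparing the
   orders of [B] and [(z - w) B] at [w] with those of [G] and [H - w G] at [phi w]
   shows that [phi] has order [1] everywhere, is injective and preserves the
   order of [B].

   Conversely, a bijective analytic [phi] has a continuous inverse, hence
   [|phi z| -> 1] at the boundary, and the maximum principle applied to [phi]
   divided by a power of a Blaschke factor shows that [phi] is a unimodular
   multiple of a Blaschke factor.  Composition with [phi] then permutes the zeros
   of [B], so [B o phi = k B] with [|k| = 1]. *)
Require Import Defs.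
From Stdlib Require Import Reals Lra Lia List Permutation Compare_dec Wf_nat.
From Stdlib Require Import Classical ClassicalEpsilon FunctionalExtensionality.
From Stdlib Require Import ssreflect ssrfun.
From Coquelicot Require Import Coquelicot.

Open Scope C_scope.

(** * Power series *)

(** The algebra need contain neither 1 nor z, so [phi] cannot be recovered from a preimage of the
    coordinate function; hence a quotient of two preimages, each carrying its own factor [B]. This
    is also why the identities of the overview contain [G ^ 2]: an equation is first multiplied up
    until both sides are in the algebra. It can then be checked after composition with [phi], and
    injectivity of the operator carries it from the range of [phi] to the whole disc, before [phi]
    is known to be onto.

    At a zero [w] of [G] the quotient formula says nothing about [w] itself; there [phi b = w] is
    obtained as a limit of the relation at nearby points. The order of [phi] at a point divides both
    the order n of [B] and the order n + 1 of [(z - w) B], hence is 1.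

    The analysis rests on local power series. Products, composition and inversion come from
    rearranging dominated double series. The maximum principle and openness both come from one local
    fact: where f is f(w) plus (z - w)^n times a cofactor that is nonzero at w, a choice of n-th
    root moves the value radially outward or inward. *)

Definition is_cseries (a : nat -> C) (l : C) : Prop :=
  @is_series C_AbsRing C_NormedModule a l.

Definition csum (a : nat -> C) (n : nat) : C :=
  @sum_n C_AbelianMonoid a n.

Lemma csum_0 a : csum a 0 = a 0%nat.
Proof. exact: sum_O. Qed.

Lemma csum_S a n : csum a (S n) = csum a n + a (S n).
Proof. exact: sum_Sn. Qed.

Lemma is_cseriesP a l :
  is_cseries a l <->
  (forall eps : R, (0 < eps)%R ->
    exists N, forall n, (N <= n)%nat -> (Cmod (csum a n - l) < eps)%R).
Proof.
rewrite /is_cseries /is_series filterlim_locally_ball_norm; split=> H.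
  by move=> eps he; have [N HN] := H (mkposreal eps he); exists N.
by move=> eps; have [N HN] := H eps (cond_pos eps); exists N.
Qed.

Lemma Cmod_minus_sym (x y : C) : Cmod (x - y) = Cmod (y - x).
Proof. by rewrite -Cmod_opp; congr Cmod; ring. Qed.

Lemma Cmod_triangle_rev (x y : C) : (Cmod x - Cmod y <= Cmod (x - y))%R.
Proof.
have h := Cmod_triangle (x - y) y.
have e : x - y + y = x by ring.
rewrite e in h; lra.
Qed.

Lemma Cmod_pos (x : C) : x <> 0 -> (0 < Cmod x)%R.
Proof. exact: (proj1 (Cmod_gt_0 x)). Qed.

Lemma Cmod_ne0 (x : C) : (0 < Cmod x)%R -> x <> 0.
Proof. exact: (proj2 (Cmod_gt_0 x)). Qed.

Lemma csum_le a (u : nat -> R) n :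
  (forall k, (k <= n)%nat -> (Cmod (a k) <= u k)%R) ->
  (Cmod (csum a n) <= sum_f_R0 u n)%R.
Proof.
elim: n => [|n IH] h /=.
  by rewrite csum_0; apply: h.
rewrite csum_S.
have h1 := Cmod_triangle (csum a n) (a (S n)).
have h2 := h (S n) (le_n _).
have h3 := IH (fun k hk => h k (le_S _ _ hk)).
lra.
Qed.

Lemma sum_half_le (M : R) n : (0 <= M)%R ->
  (sum_f_R0 (fun k => M * (1 / 2) ^ k) n <= 2 * M)%R.
Proof.
move=> hM.
have e : (sum_f_R0 (fun k => M * (1 / 2) ^ k) n = 2 * M - M * (1 / 2) ^ n)%R.
  elim: n => [|n IH] /=; first by lra.
  rewrite IH /=; lra.
have h := pow_le (1/2) n; rewrite e; nra.
Qed.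

Lemma is_cseries_le_const a l (M : R) :
  is_cseries a l -> (forall n, (Cmod (csum a n) <= M)%R) -> (Cmod l <= M)%R.
Proof.
move=> /is_cseriesP h hM; apply: Rnot_lt_le => hl.
have [N HN] := h (Cmod l - M)%R ltac:(lra).
have h1 := HN N (le_n _); have h2 := hM N.
rewrite Cmod_minus_sym in h1.
have := Cmod_triangle_rev l (csum a N); lra.
Qed.

Lemma is_cseries_half_le a l (M : R) : (0 <= M)%R ->
  is_cseries a l -> (forall n, (Cmod (a n) <= M * (1 / 2) ^ n)%R) ->
  (Cmod l <= 2 * M)%R.
Proof.
move=> hM hl ha; apply: (is_cseries_le_const _ _ _ hl) => n.
apply: Rle_trans (sum_half_le M n hM).
by apply: csum_le => k _.
Qed.

Lemma ex_cseries_half a (M : R) :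
  (forall n, (Cmod (a n) <= M * (1 / 2) ^ n)%R) -> exists l, is_cseries a l.
Proof.
move=> ha.
have [|l hl] := @ex_series_le C_AbsRing C_CompleteNormedModule a
  (fun n => M * (1 / 2) ^ n)%R ha.
  apply: ex_series_scal_l; apply: ex_series_geom.
  rewrite Rabs_pos_eq; lra.
by exists l.
Qed.

Lemma is_cseries_ext a b l :
  (forall n, a n = b n) -> is_cseries a l -> is_cseries b l.
Proof. exact: is_series_ext. Qed.

Lemma is_cseries_plus a b la lb :
  is_cseries a la -> is_cseries b lb -> is_cseries (fun n => a n + b n) (la + lb).
Proof. exact: is_series_plus. Qed.

Lemma is_cseries_scal c a l :
  is_cseries a l -> is_cseries (fun n => c * a n) (c * l).
Proof. exact: is_series_scal. Qed.

Lemma is_cseries_minus a b la lb :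
  is_cseries a la -> is_cseries b lb -> is_cseries (fun n => a n - b n) (la - lb).
Proof.
move=> ha hb.
have -> : la - lb = la + (-(1)) * lb by ring.
apply: (is_cseries_ext (fun n => a n + (-(1)) * b n)) => [n|]; first by ring.
by apply: is_cseries_plus => //; apply: is_cseries_scal.
Qed.

Lemma is_cseries_finite (a : nat -> C) N :
  (forall n, (N < n)%nat -> a n = 0) -> is_cseries a (csum a N).
Proof.
move=> h; apply/is_cseriesP => eps he; exists N => n hn.
have -> : csum a n = csum a N.
  elim: n hn => [|n IH] hn; first by have -> : N = 0%nat by lia.
  case: (Nat.eq_dec N (S n)) => [->//|hne].
  rewrite csum_S IH; last by lia.
  rewrite h; last by lia.
  by ring.
have -> : csum a N - csum a N = 0 by ring.
by rewrite Cmod_0.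
Qed.

Lemma csum_shift a n m :
  csum (fun k => a (n + S k)%nat) m + csum a n = csum a (n + S m).
Proof.
elim: m => [|m IH].
  by rewrite csum_0 !Nat.add_succ_r Nat.add_0_r csum_S; ring.
rewrite csum_S [(n + S (S m))%nat]Nat.add_succ_r csum_S -IH.
by rewrite Nat.add_succ_r; ring.
Qed.

(** [csum a n] has n + 1 terms, so the tail starts at index [n + S k]. Removing no term at all is
    not an instance, which is why later proofs treat a shift by 0 separately. *)
Lemma is_cseries_shift a l n :
  is_cseries (fun k => a (n + S k)%nat) (l - csum a n) <-> is_cseries a l.
Proof.
rewrite !is_cseriesP; split=> h eps he; have [N HN] := h eps he.
  exists (n + S N)%nat => m hm.
  have -> : m = (n + S (m - S n))%nat by lia.
  rewrite -csum_shift.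
  have := HN (m - S n)%nat ltac:(lia).
  by congr Rlt; congr Cmod; ring.
exists N => m hm.
have := HN (n + S m)%nat ltac:(lia).
rewrite -csum_shift.
by congr Rlt; congr Cmod; ring.
Qed.

Lemma is_cseries_uniq a l l' : is_cseries a l -> is_cseries a l' -> l = l'.
Proof.
move=> /is_cseriesP h /is_cseriesP h'.
apply: NNPP => hne.
have hd : (0 < Cmod (l - l'))%R.
  by apply: Cmod_pos => e; apply: hne; rewrite -(Cplus_0_r l') -e; ring.
have [N HN] := h (Cmod (l - l') / 2)%R ltac:(lra).
have [N' HN'] := h' (Cmod (l - l') / 2)%R ltac:(lra).
have h1 := HN (N + N')%nat ltac:(lia).
have h2 := HN' (N + N')%nat ltac:(lia).
set s := csum a (N + N') in h1 h2.
rewrite Cmod_minus_sym in h1.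
have := Cmod_triangle (l - s) (s - l').
have -> : l - s + (s - l') = l - l' by ring.
lra.
Qed.

Lemma is_cseries_csum (c : nat -> nat -> C) (d : nat -> C) K :
  (forall k, is_cseries (fun n => c n k) (d k)) ->
  is_cseries (fun n => csum (c n) K) (csum d K).
Proof.
move=> h; elim: K => [|K IH].
  rewrite csum_0; apply: (is_cseries_ext (fun n => c n 0%nat)) => // n.
  by rewrite csum_0.
rewrite csum_S; apply: (is_cseries_ext (fun n => csum (c n) K + c n (S K))).
  by move=> n; rewrite csum_S.
exact: is_cseries_plus.
Qed.

(* Fubini for double series; domination by a geometric sequence makes the
   tails in [k] uniformly summable in [n]. *)
Lemma is_cseries_swap (c : nat -> nat -> C) (s d : nat -> C) (l : C) (M : R) :
  (0 <= M)%R ->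
  (forall n k, (Cmod (c n k) <= M * (1 / 2) ^ n * (1 / 2) ^ k)%R) ->
  (forall n, is_cseries (c n) (s n)) -> is_cseries s l ->
  (forall k, is_cseries (fun n => c n k) (d k)) ->
  is_cseries d l.
Proof.
move=> hM hc hs hl hd; apply/is_cseriesP => eps he.
have [N HN] : exists N, forall n, (N <= n)%nat -> (4 * M * (1 / 2) ^ n < eps)%R.
  have hp : (0 < eps / (4 * M + 1))%R by apply: Rdiv_lt_0_compat; lra.
  have h2 : (Rabs (1/2) < 1)%R by rewrite Rabs_pos_eq; lra.
  have [N HN] := pow_lt_1_zero (1/2) h2 _ hp.
  exists N => n hn; have h := HN n hn.
  have h0 : (0 < (1/2) ^ n)%R by apply: pow_lt; lra.
  rewrite Rabs_pos_eq in h; last by lra.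
  have h1 : ((1/2) ^ n * (4 * M + 1) < eps)%R.
    have := Rmult_lt_compat_r (4 * M + 1) _ _ ltac:(lra) h.
    by have -> : (eps / (4 * M + 1) * (4 * M + 1) = eps)%R by field; lra.
  nra.
exists N => K hK.
apply: Rle_lt_trans (HN K hK).
(* The remainder [l - csum d K] is the sum over n of the row tails beyond K; each tail is at most
   [2 M (1/2)^n (1/2)^K], so the remainder is at most [4 M (1/2)^K]. *)
have h1 := is_cseries_minus _ _ _ _ hl (is_cseries_csum c d K hd).
rewrite Cmod_minus_sym.
have hK0 : (0 <= (1/2) ^ K)%R by apply: pow_le; lra.
have := is_cseries_half_le _ _ (2 * M * (1 / 2) ^ K) _ h1 _.
have -> : (2 * (2 * M * (1 / 2) ^ K) = 4 * M * (1/2) ^ K)%R by ring.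
apply; first by nra.
move=> n.
have h2 := proj2 (is_cseries_shift (c n) (s n) K) (hs n).
have hn0 : (0 <= (1/2) ^ n)%R by apply: pow_le; lra.
have hMn : (0 <= M * (1/2) ^ n)%R by nra.
have := is_cseries_half_le _ _ (M * (1 / 2) ^ n * (1 / 2) ^ K) _ h2 _.
have -> : (2 * (M * (1 / 2) ^ n * (1 / 2) ^ K) = 2 * M * (1 / 2) ^ K * (1 / 2) ^ n)%R by ring.
apply; first by nra.
move=> k; apply: Rle_trans (hc _ _) _.
rewrite Nat.add_succ_r -Nat.add_succ_l pow_add /=.
have hk0 : (0 <= (1/2) ^ k)%R by apply: pow_le; lra.
have : (0 <= (1/2) ^ K * (1/2) ^ k)%R by nra.
nra.
Qed.

(** * Products and powers of power series *)

Definition is_ps (a : nat -> C) (t l : C) : Prop :=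
  is_cseries (fun k => t ^ k * a k) l.

Lemma csum_scal c a n : csum (fun k => c * a k) n = c * csum a n.
Proof. by elim: n => [|n IH]; rewrite ?csum_0 ?csum_S // IH; ring. Qed.

Lemma csum_ext a b n :
  (forall k, (k <= n)%nat -> a k = b k) -> csum a n = csum b n.
Proof.
elim: n => [|n IH] h; first by rewrite !csum_0 h.
by rewrite !csum_S IH ?h // => k hk; apply: h; lia.
Qed.

Lemma finite_bound (u : nat -> R) N :
  exists M, (0 <= M)%R /\ forall k, (k <= N)%nat -> (u k <= M)%R.
Proof.
elim: N => [|N [M [hM IH]]].
  exists (Rmax 0 (u 0%nat)); split; first by apply: Rmax_l.
  move=> k hk; have -> : k = 0%nat by lia.
  exact: Rmax_r.
exists (Rmax M (u (S N))); split; first by apply: Rle_trans hM (Rmax_l _ _).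
move=> k hk; case: (Nat.eq_dec k (S N)) => [->|hne]; first by apply: Rmax_r.
by apply: Rle_trans (IH k ltac:(lia)) (Rmax_l _ _).
Qed.

(** A term is the difference of two consecutive partial sums. Beyond some N both are within 1 of the
    limit, hence the 2 added to the maximum of the first terms. *)
Lemma is_ps_bound a t l : is_ps a t l ->
  exists M, (0 <= M)%R /\ forall k, (Cmod (a k) * Cmod t ^ k <= M)%R.
Proof.
move=> /is_cseriesP h.
have [N HN] := h 1%R Rlt_0_1.
have [M [hM HM]] := finite_bound (fun k => Cmod (a k) * Cmod t ^ k)%R N.
exists (M + 2)%R; split; first by lra.
move=> k; case: (le_lt_dec k N) => hk; first by have := HM k hk; lra.
have [j ej] : exists j, k = S j by exists (k - 1)%nat; lia.
have h1 := HN k ltac:(lia); have h2 := HN j ltac:(lia).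
rewrite ej csum_S in h1 *.
set s := csum _ j in h1 h2.
rewrite -Cmod_pow Rmult_comm -Cmod_mult.
have := Cmod_triangle_rev (t ^ S j * a (S j)) (- (s - l)).
rewrite Cmod_opp.
have -> : t ^ S j * a (S j) - - (s - l) = s + t ^ S j * a (S j) - l by ring.
lra.
Qed.

Definition cauchy_coef (a b : nat -> C) (k : nat) : C :=
  csum (fun n => a n * b (k - n)%nat) k.

(** A quarter of the radius yields two factors [(1/2)^k], one to pay for each index of a double
    series. *)
Lemma pow_quarter (x y : R) k : (0 <= x)%R -> (0 < y)%R -> (x <= y / 4)%R ->
  (x ^ k <= (1 / 2) ^ k * (1 / 2) ^ k * y ^ k)%R.
Proof.
move=> hx hy h; rewrite -!Rpow_mult_distr; apply: pow_incr; lra.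
Qed.

Lemma half_pow_anti n k : (n <= k)%nat -> ((1 / 2) ^ k <= (1 / 2) ^ n)%R.
Proof.
move=> h; have -> : k = (n + (k - n))%nat by lia.
rewrite pow_add.
have h1 : (0 <= (1/2) ^ n)%R by apply: pow_le; lra.
have h2 : ((1/2) ^ (k - n) <= 1 ^ (k - n))%R by apply: pow_incr; lra.
rewrite pow1 in h2; nra.
Qed.

Lemma is_ps_mult a b t f g (x M M' : R) :
  (0 < x)%R -> (Cmod t <= x / 4)%R ->
  (forall k, (Cmod (a k) * x ^ k <= M)%R) ->
  (forall k, (Cmod (b k) * x ^ k <= M')%R) ->
  is_ps a t f -> is_ps b t g -> is_ps (cauchy_coef a b) t (f * g).
Proof.
move=> hx ht ha hb hf hg.
(* Row n is the n-th term of the first series times the second series, moved n places to the right;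
   column k is finite and sums to the k-th term of the Cauchy product. *)
pose c n k := if (n <=? k)%nat then t ^ k * (a n * b (k - n)%nat) else 0.
have hM : (0 <= M)%R.
  by apply: Rle_trans (ha 0%nat); rewrite /= Rmult_1_r; apply: Cmod_ge_0.
have hM' : (0 <= M')%R.
  by apply: Rle_trans (hb 0%nat); rewrite /= Rmult_1_r; apply: Cmod_ge_0.
apply: (is_cseries_swap c (fun n => t ^ n * a n * g) _ _ (M * M')); first by nra.
- move=> n k; rewrite /c.
  have hn : (0 <= (1/2) ^ n)%R by apply: pow_le; lra.
  have hk : (0 <= (1/2) ^ k)%R by apply: pow_le; lra.
  have hMM : (0 <= M * M')%R by nra.
  case: Nat.leb_spec => h; last first.
    by rewrite Cmod_0; apply: Rmult_le_pos => //; apply: Rmult_le_pos.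
  rewrite !Cmod_mult Cmod_pow.
  have h1 := pow_quarter (Cmod t) x k (Cmod_ge_0 _) hx ht.
  have h2 := half_pow_anti n k h.
  have e : (x ^ k = x ^ n * x ^ (k - n))%R by rewrite -pow_add; congr pow; lia.
  have h3 : (Cmod (a n) * Cmod (b (k - n)%nat) * x ^ k <= M * M')%R.
    rewrite e.
    have -> : (Cmod (a n) * Cmod (b (k - n)%nat) * (x ^ n * x ^ (k - n)) =
      (Cmod (a n) * x ^ n) * (Cmod (b (k - n)%nat) * x ^ (k - n)))%R by ring.
    apply: Rmult_le_compat => //; apply: Rmult_le_pos; try exact: Cmod_ge_0; apply: pow_le; lra.
  set A := Cmod (a n) in h3 *; set A' := Cmod (b (k - n)%nat) in h3 *.
  have hA : (0 <= A * A')%R by apply: Rmult_le_pos; apply: Cmod_ge_0.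
  apply: (Rle_trans _ (((1 / 2) ^ k * (1 / 2) ^ k) * (A * A' * x ^ k))%R).
    have := Rmult_le_compat_r _ _ _ hA h1; nra.
  apply: (Rle_trans _ (((1 / 2) ^ k * (1 / 2) ^ k) * (M * M'))%R).
    apply: Rmult_le_compat_l => //; nra.
  have : ((1 / 2) ^ k * (1 / 2) ^ k <= (1 / 2) ^ n * (1 / 2) ^ k)%R by nra.
  move=> h4; have := Rmult_le_compat_r _ _ _ hMM h4; nra.
- move=> n.
  have h : is_cseries (fun k => t ^ n * a n * (t ^ k * b k)) (t ^ n * a n * g).
    exact: is_cseries_scal.
  have hc k : c n (n + k)%nat = t ^ n * a n * (t ^ k * b k).
    rewrite /c; case: Nat.leb_spec => hh; last by lia.
    have -> : (n + k - n)%nat = k by lia.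
    by rewrite Cpow_add_r; ring.
  case: n h hc => [|n] h hc.
    by apply: is_cseries_ext h => k; rewrite -hc.
  apply/(is_cseries_shift _ _ n).
  have -> : csum (c (S n)) n = 0.
    rewrite (csum_ext _ (fun k => 0 * 0)) ?csum_scal; first by ring.
    by move=> k hk; rewrite /c; case: Nat.leb_spec => hh; [lia | ring].
  have -> : t ^ S n * a (S n) * g - 0 = t ^ S n * a (S n) * g by ring.
  by apply: is_cseries_ext h => k; rewrite -hc Nat.add_succ_r.
- have -> : f * g = g * f by ring.
  apply: is_cseries_ext (is_cseries_scal g _ _ hf) => n; ring.
- move=> k.
  have -> : t ^ k * cauchy_coef a b k = csum (fun n => c n k) k.
    rewrite /cauchy_coef -csum_scal; apply: csum_ext => n hn.
    by rewrite /c; case: Nat.leb_spec => hh //; lia.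
  apply: (is_cseries_finite (fun n => c n k) k) => n hn.
  by rewrite /c; case: Nat.leb_spec => hh //; lia.
Qed.

Fixpoint pow_coef (b : nat -> C) (n : nat) : nat -> C :=
  match n with
  | 0%nat => fun k => if (k =? 0)%nat then 1 else 0
  | S n => cauchy_coef b (pow_coef b n)
  end.

(** With weights [x ^ k], the supremum norm of a Cauchy product is at most the l1 norm of one factor
    times the supremum norm of the other; [sigma] bounds the l1 norm of [b]. *)
Lemma pow_coef_bound b (x sigma : R) :
  (0 < x)%R -> (0 <= sigma)%R ->
  (forall n, (sum_f_R0 (fun k => Cmod (b k) * x ^ k) n <= sigma)%R) ->
  forall n k, (Cmod (pow_coef b n k) * x ^ k <= sigma ^ n)%R.
Proof.
move=> hx hs hb; elim=> [|n IH] k /=.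
  case: Nat.eqb_spec => [->|hk] /=; first by rewrite Cmod_1; lra.
  by rewrite Cmod_0; lra.
rewrite /cauchy_coef.
have hxk : (0 <= x ^ k)%R by apply: pow_le; lra.
have hsn : (0 <= sigma ^ n)%R by apply: pow_le; lra.
have -> : (Cmod (csum (fun j => (b j * pow_coef b n (k - j)%nat)%C) k) * x ^ k)%R =
  Cmod (csum (fun j => RtoC (x ^ k) * (b j * pow_coef b n (k - j)%nat)) k).
  by rewrite csum_scal Cmod_mult Cmod_R Rabs_pos_eq // Rmult_comm.
apply: Rle_trans (csum_le _ (fun j => Cmod (b j) * x ^ j * sigma ^ n)%R k _) _.
  move=> j hj; rewrite !Cmod_mult Cmod_R Rabs_pos_eq //.
  have -> : (x ^ k = x ^ j * x ^ (k - j))%R by rewrite -pow_add; congr pow; lia.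
  have h := IH (k - j)%nat.
  have hj0 : (0 <= Cmod (b j) * x ^ j)%R.
    by apply: Rmult_le_pos; [exact: Cmod_ge_0 | apply: pow_le; lra].
  have := Rmult_le_compat_l _ _ _ hj0 h; nra.
rewrite -scal_sum.
by rewrite Rmult_comm; apply: Rmult_le_compat_r.
Qed.

(** Germs at 0 of functions on all of [C] keep the calculus of power series free of the base point
    and of the subtype [unit_disc]. *)
Definition germ_analytic (F : C -> C) : Prop :=
  exists a r, (0 < r)%R /\ forall t, (Cmod t < r)%R -> is_ps a t (F t).

Lemma Cmod_Rpos (x : R) : (0 <= x)%R -> Cmod x = x.
Proof. by move=> h; rewrite Cmod_R Rabs_pos_eq. Qed.

Lemma ps_coef_bound a r F : (0 < r)%R ->
  (forall t, (Cmod t < r)%R -> is_ps a t (F t)) ->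
  forall x, (0 < x < r)%R ->
  exists M, (0 <= M)%R /\ forall k, (Cmod (a k) * x ^ k <= M)%R.
Proof.
move=> hr h x hx.
have hm : Cmod x = x by apply: Cmod_Rpos; lra.
have [|M [hM HM]] := is_ps_bound a x (F x); first by apply: h; rewrite hm; lra.
by exists M; rewrite hm in HM.
Qed.

Lemma germ_mult F G : germ_analytic F -> germ_analytic G ->
  germ_analytic (fun t => F t * G t).
Proof.
move=> [a [r [hr ha]]] [b [r' [hr' hb]]].
have hm := Rmin_glb_lt _ _ _ hr hr'.
have h1 := Rmin_l r r'; have h2 := Rmin_r r r'.
set x := (Rmin r r' / 2)%R.
have hx : (0 < x)%R by rewrite /x; lra.
have [M [_ HM]] := ps_coef_bound a r F hr ha x ltac:(rewrite /x; lra).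
have [M' [_ HM']] := ps_coef_bound b r' G hr' hb x ltac:(rewrite /x; lra).
exists (cauchy_coef a b), (x / 4)%R; split; first by lra.
move=> t ht; apply: (is_ps_mult _ _ _ _ _ x M M') => //; first by lra.
  by apply: ha; rewrite /x in ht; lra.
by apply: hb; rewrite /x in ht; lra.
Qed.

Lemma germ_plus F G : germ_analytic F -> germ_analytic G ->
  germ_analytic (fun t => F t + G t).
Proof.
move=> [a [r [hr ha]]] [b [r' [hr' hb]]].
have hm := Rmin_glb_lt _ _ _ hr hr'.
have h1 := Rmin_l r r'; have h2 := Rmin_r r r'.
exists (fun k => a k + b k), (Rmin r r'); split=> // t ht.
apply: (is_cseries_ext (fun k => t ^ k * a k + t ^ k * b k)) => [k|]; first by ring.
by apply: is_cseries_plus; [apply: ha | apply: hb]; lra.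
Qed.

Lemma germ_const c : germ_analytic (fun _ => c).
Proof.
exists (fun k => if (k =? 0)%nat then c else 0), 1%R; split; first by lra.
move=> t _; rewrite /is_ps.
have {2}-> : c = csum (fun k => t ^ k * (if (k =? 0)%nat then c else 0)) 0.
  by rewrite csum_0 /=; ring.
by apply: is_cseries_finite => n hn; case: Nat.eqb_spec => h; [lia | ring].
Qed.

Lemma germ_id : germ_analytic (fun t => t).
Proof.
exists (fun k => if (k =? 1)%nat then 1 else 0), 1%R; split; first by lra.
move=> t _; rewrite /is_ps.
have {2}-> : t = csum (fun k => t ^ k * (if (k =? 1)%nat then 1 else 0)) 1.
  by rewrite csum_S csum_0 /=; ring.
by apply: is_cseries_finite => n hn; case: Nat.eqb_spec => h; [lia | ring].
Qed.

Lemma germ_ext F G (r : R) : (0 < r)%R ->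
  (forall t, (Cmod t < r)%R -> F t = G t) -> germ_analytic F -> germ_analytic G.
Proof.
move=> hr h [a [r' [hr' ha]]].
have hm := Rmin_glb_lt _ _ _ hr hr'.
have h1 := Rmin_l r r'; have h2 := Rmin_r r r'.
exists a, (Rmin r r'); split=> // t ht.
by rewrite -h; [apply: ha|]; lra.
Qed.

Lemma is_ps_0 a : is_ps a 0 (a 0%nat).
Proof.
rewrite /is_ps.
have -> : a 0%nat = csum (fun k => 0 ^ k * a k) 0 by rewrite csum_0 /=; ring.
apply: is_cseries_finite => n hn; case: n hn => [|n] hn; first by lia.
by rewrite Cpow_S; ring.
Qed.

Lemma choice_seq (P : nat -> C -> Prop) :
  (forall n, exists x, P n x) -> exists u : nat -> C, forall n, P n (u n).
Proof.
move=> h; exists (fun n => proj1_sig (constructive_indefinite_description _ (h n))).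
by move=> n; case: constructive_indefinite_description.
Qed.

(** Expand F(G(t)) as the sum of [a n * G t ^ n], insert the series of each power of G and exchange
    the summations. Since [G 0 = 0], the absolute series of G can be made at most r/4 by shrinking
    x; against the bound of [a] at r/2 this gains [(1/2)^n], and shrinking t gains [(1/2)^k]. *)
Lemma germ_comp F G : germ_analytic F -> germ_analytic G -> G 0 = 0 ->
  germ_analytic (fun t => F (G t)).
Proof.
move=> [a [r [hr ha]]] [b [s [hs hb]]] hG0.
have [Ma [hMa HMa]] := ps_coef_bound a r F hr ha (r/2) ltac:(lra).
have [Mb [hMb HMb]] := ps_coef_bound b s G hs hb (s/2) ltac:(lra).
have hb0 : b 0%nat = 0.
  rewrite -hG0; apply: is_cseries_uniq (is_ps_0 b) _; apply: hb.
  by rewrite Cmod_0.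
(* [x] is chosen such that [\sum_k |b k| x ^ k <= r / 4]. *)
set x := Rmin (s / 4) (r * s / (32 * (Mb + 1))).
set sigma := (r / 4)%R.
have hrs : (0 < r * s)%R by nra.
have hx : (0 < x)%R.
  apply: Rmin_glb_lt; first by lra.
  by apply: Rdiv_lt_0_compat; lra.
have hx1 : (x <= s / 4)%R by apply: Rmin_l.
have hx2 : (8 * Mb * x / s <= sigma)%R.
  have h : (x <= r * s / (32 * (Mb + 1)))%R by apply: Rmin_r.
  have h' : (x * (32 * (Mb + 1)) <= r * s)%R.
    have := Rmult_le_compat_r (32 * (Mb + 1)) _ _ ltac:(lra) h.
    by have -> : (r * s / (32 * (Mb + 1)) * (32 * (Mb + 1)) = r * s)%R by field; lra.
  apply: (Rmult_le_reg_r s) => //.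
  have -> : (8 * Mb * x / s * s = 8 * Mb * x)%R by field; lra.
  rewrite /sigma; nra.
have hsum n : (sum_f_R0 (fun k => Cmod (b k) * x ^ k) n <= sigma)%R.
  apply: Rle_trans hx2.
  (* With [q = 2 x / s], at most 1/2, the term of index k + 1 is at most [Mb q^(k+1)], hence at most
     [D (1/2)^k]. The sum is at most [4 D], and the 32 in [x] makes this at most [r / 4]. *)
  set D := (2 * Mb * x / s)%R.
  have hD : (0 <= D)%R.
    apply: Rmult_le_pos; last by apply/Rlt_le/Rinv_0_lt_compat.
    by apply: Rmult_le_pos; lra.
  apply: Rle_trans (sum_Rle _ (fun k => 2 * D * (1 / 2) ^ k)%R n _) _; last first.
    have := sum_half_le D n hD.
    have -> : (sum_f_R0 (fun k => 2 * D * (1 / 2) ^ k) n =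
      2 * sum_f_R0 (fun k => D * (1 / 2) ^ k) n)%R.
      rewrite scal_sum; apply: sum_eq => i _; ring.
    have -> : (8 * Mb * x / s = 4 * D)%R by rewrite /D; field; lra.
    lra.
  move=> k _; case: k => [|k]; first by rewrite hb0 Cmod_0 /=; lra.
  have h1 := HMb (S k).
  set q := (2 * x / s)%R.
  have hq : (0 <= q <= 1/2)%R.
    split; first by apply: Rmult_le_pos; [lra | apply/Rlt_le/Rinv_0_lt_compat].
    apply: (Rmult_le_reg_r s) => //.
    have -> : (q * s = 2 * x)%R by rewrite /q; field; lra.
    lra.
  have e : (x = (s / 2) * q)%R by rewrite /q; field; lra.
  rewrite e Rpow_mult_distr.
  have hqk : (0 <= q ^ k)%R by apply: pow_le; lra.
  have hqk' : (q ^ k <= (1/2) ^ k)%R by apply: pow_incr; lra.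
  have eD : (2 * D = 2 * (Mb * q))%R by rewrite /D /q; field; lra.
  rewrite eD /=.
  set A := (Cmod (b (S k)) * (s / 2) ^ S k)%R in h1 *.
  have -> : (Cmod (b (S k)) * (s / 2 * (s / 2) ^ k * (q * q ^ k)) = A * (q * q ^ k))%R.
    by rewrite /A /=; ring.
  have hq2 : (0 <= q * q ^ k)%R by nra.
  have := Rmult_le_compat_r _ _ _ hq2 h1.
  have : (q * q ^ k <= q * (1/2) ^ k)%R by nra.
  move=> h3; have := Rmult_le_compat_l _ _ _ hMb h3; lra.
have hsig : (0 <= sigma)%R by rewrite /sigma; lra.
have hE := pow_coef_bound b x sigma hx hsig hsum.
have hak n : (Cmod (a n) * sigma ^ n <= Ma * (1/2) ^ n)%R.
  have -> : (sigma ^ n = (r/2) ^ n * (1/2) ^ n)%R.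
    by rewrite -Rpow_mult_distr; congr pow; rewrite /sigma; lra.
  have := HMa n; have hn : (0 <= (1/2) ^ n)%R by apply: pow_le; lra.
  nra.
have haE n k : (Cmod (a n * pow_coef b n k) * x ^ k <= Ma * (1/2) ^ n)%R.
  apply: Rle_trans (hak n); rewrite Cmod_mult.
  have := Rmult_le_compat_l _ _ _ (Cmod_ge_0 (a n)) (hE n k); lra.
have [e he] : exists e : nat -> C,
    forall k, is_cseries (fun n => a n * pow_coef b n k) (e k).
  apply: (choice_seq (fun k l => is_cseries (fun n => a n * pow_coef b n k) l)) => k.
  apply: (ex_cseries_half _ (Ma / x ^ k)%R) => n.
  have hxk : (0 < x ^ k)%R by apply: pow_lt.
  apply: (Rmult_le_reg_r (x ^ k)) => //.
  apply: Rle_trans (haE n k) _; apply: Req_le; field; lra.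
exists e, (x / 4)%R; split; first by lra.
move=> t ht.
have htG : is_ps b t (G t) by apply: hb; lra.
have hpow n : is_ps (pow_coef b n) t (G t ^ n).
  elim: n => [|n IH].
    have {1}-> : G t ^ 0 = csum (fun k => t ^ k * pow_coef b 0 k) 0.
      by rewrite csum_0 /=; ring.
    by apply: is_cseries_finite => n hn /=; case: Nat.eqb_spec => h; [lia | ring].
  rewrite Cpow_S; apply: (is_ps_mult _ _ _ _ _ x sigma (sigma ^ n)) => //; first by lra.
  move=> k; apply: Rle_trans (hsum k).
  case: k => [|k] /=; first by lra.
  have : (0 <= sum_f_R0 (fun j => Cmod (b j) * x ^ j) k)%R.
    apply: cond_pos_sum => j; apply: Rmult_le_pos; first by exact: Cmod_ge_0.
    by apply: pow_le; lra.
  lra.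
have hGt : (Cmod (G t) < r)%R.
  have : (Cmod (G t) <= sigma)%R.
    apply: is_cseries_le_const htG _ => n.
    apply: Rle_trans (hsum n); apply: csum_le => k _.
    rewrite Cmod_mult Cmod_pow Rmult_comm.
    apply: Rmult_le_compat_l; first by exact: Cmod_ge_0.
    by apply: pow_incr; split; [exact: Cmod_ge_0 | lra].
  rewrite /sigma; lra.
apply: (is_cseries_swap (fun n k => t ^ k * (a n * pow_coef b n k))
  (fun n => G t ^ n * a n) _ _ Ma) => //.
- move=> n k; rewrite Cmod_mult Cmod_pow.
  have h1 : (Cmod t ^ k <= (x * (1/2)) ^ k)%R.
    by apply: pow_incr; split; [exact: Cmod_ge_0 | lra].
  rewrite Rpow_mult_distr in h1.
  have hk : (0 <= (1/2) ^ k)%R by apply: pow_le; lra.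
  have := Rmult_le_compat_r _ _ _ hk (haE n k).
  have := Rmult_le_compat_r _ _ _ (Cmod_ge_0 (a n * pow_coef b n k)) h1.
  lra.
- move=> n; have -> : G t ^ n * a n = a n * G t ^ n by ring.
  by apply: is_cseries_ext (is_cseries_scal (a n) _ _ (hpow n)) => k; ring.
- exact: ha.
- move=> k; exact: is_cseries_scal (he k).
Qed.

(** Geometric series in q = -t/c; its sum l is identified through [l - 1 = q * l]. *)
Lemma germ_inv_at (c : C) : c <> 0 -> germ_analytic (fun t => / (c + t)).
Proof.
move=> hc; have hc' := Cmod_pos _ hc.
exists (fun k => (- / c) ^ k * / c), (Cmod c / 2)%R; split; first by lra.
move=> t ht.
have hq : (Cmod (t * - / c) <= 1/2)%R.
  rewrite Cmod_mult Cmod_opp Cmod_inv //.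
  apply: (Rmult_le_reg_r (Cmod c)) => //.
  have -> : (Cmod t * / Cmod c * Cmod c = Cmod t)%R by field; lra.
  lra.
have hct : c + t <> 0.
  apply: Cmod_ne0; have := Cmod_triangle_rev c (- t); rewrite Cmod_opp.
  have -> : c - - t = c + t by ring.
  lra.
set q := t * - / c in hq.
apply: (is_cseries_ext (fun k => / c * q ^ k)).
  by move=> k; rewrite /q Cpow_mult_l; ring.
have [l hl] := ex_cseries_half (fun k => q ^ k) 1 (fun n => ltac:(
  rewrite Cmod_pow Rmult_1_l; apply: pow_incr; split; [exact: Cmod_ge_0 | lra])).
have e : l - 1 = q * l.
  apply: is_cseries_uniq (is_cseries_scal q _ _ hl).
  have := proj2 (is_cseries_shift _ _ 0) hl; rewrite csum_0.
  by apply: is_cseries_ext => n.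
have -> : / (c + t) = / c * l.
  have e1 : l * (c + t) = c.
    have e2 : l = 1 + q * l by rewrite -e; ring.
    have e3 : q * c = - t by rewrite /q; field.
    have -> : l * (c + t) = l * c + l * t by ring.
    rewrite {1}e2.
    have -> : (1 + q * l) * c + l * t = c + l * (q * c + t) by ring.
    by rewrite e3; ring.
  have -> : / c * l = (l * (c + t)) * / c * / (c + t) by field.
  by rewrite e1; field.
exact: is_cseries_scal.
Qed.

Lemma germ_inv F : germ_analytic F -> F 0 <> 0 -> germ_analytic (fun t => / F t).
Proof.
move=> hF h0.
have h := germ_comp _ (fun t => F t - F 0) (germ_inv_at _ h0) _ _.
apply: (germ_ext (fun t => / (F 0 + (F t - F 0))) _ 1 Rlt_0_1).
  by move=> t _; congr Cinv; ring.
apply: h; last by ring.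
exact: germ_plus hF (germ_const (- F 0)).
Qed.

(** * Analytic functions on the disc *)

Implicit Types (f g u v : unit_disc -> C) (w z : unit_disc).

Lemma disc_eq (z w : unit_disc) : (z : C) = w -> z = w.
Proof.
case: z w => [z hz] [w hw] /= e; subst w.
by congr exist; apply: proof_irrelevance.
Qed.

Lemma disc_lt1 (z : unit_disc) : (Cmod z < 1)%R.
Proof. exact: proj2_sig z. Qed.

Lemma disc_of (z : C) : (Cmod z < 1)%R -> exists u : unit_disc, (u : C) = z.
Proof. by move=> h; exists (exist _ z h). Qed.

Lemma disc_shift (w : unit_disc) (t : C) :
  (Cmod t < 1 - Cmod w)%R -> exists u : unit_disc, (u : C) = w + t.
Proof.
move=> h; apply: disc_of; apply: Rle_lt_trans (Cmod_triangle _ _) _; lra.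
Qed.

(* Extension by the junk value [0], so that germs can be taken on [C]. *)
Definition disc_ext (f : unit_disc -> C) (z : C) : C :=
  match excluded_middle_informative (Cmod z < 1)%R with
  | left h => f (exist _ z h)
  | right _ => 0
  end.

Lemma disc_extE f (z : unit_disc) : disc_ext f z = f z.
Proof.
rewrite /disc_ext; case: excluded_middle_informative => [h|]; last first.
  by move=> h; case: h; apply: disc_lt1.
by congr f; apply: disc_eq.
Qed.

Definition germ_at (f : unit_disc -> C) (w : unit_disc) (t : C) : C :=
  disc_ext f (w + t).

Lemma germ_at0 f w : germ_at f w 0 = f w.
Proof. by rewrite /germ_at Cplus_0_r disc_extE. Qed.

Lemma power_series_atP f w a :
  power_series_at f w a <->
  exists r, (0 < r)%R /\ forall t, (Cmod t < r)%R -> is_ps a t (germ_at f w t).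
Proof.
have hw := disc_lt1 w.
split=> [[r [hr h]]|[r [hr h]]].
  exists (Rmin r (1 - Cmod w)); split; first by apply: Rmin_glb_lt; lra.
  move=> t ht.
  have h1 := Rmin_l r (1 - Cmod w); have h2 := Rmin_r r (1 - Cmod w).
  have [u hu] := disc_shift w t ltac:(lra).
  have e : t = u - w by rewrite hu; ring.
  rewrite /germ_at -hu disc_extE e; apply: h; rewrite -e; lra.
exists r; split=> // z hz.
have := h _ hz; rewrite /germ_at.
have -> : w + (z - w) = z by ring.
by rewrite disc_extE.
Qed.

Lemma analyticP f :
  analytic f <-> forall w, germ_analytic (germ_at f w).
Proof.
split=> h w.
  by have [a /power_series_atP [r hr]] := h w; exists a, r.
have [a [r hr]] := h w; exists a; apply/power_series_atP; by exists r.
Qed.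

Lemma germ_at_ext (f : unit_disc -> C) (w : unit_disc) (F : C -> C) (r : R) :
  (0 < r)%R -> (forall z : unit_disc, (Cmod (z - w) < r)%R -> F (z - w) = f z) ->
  germ_analytic F -> germ_analytic (germ_at f w).
Proof.
move=> hr h; have hw := disc_lt1 w.
apply: (germ_ext _ _ (Rmin r (1 - Cmod w))); first by apply: Rmin_glb_lt; lra.
move=> t ht.
have h1 := Rmin_l r (1 - Cmod w); have h2 := Rmin_r r (1 - Cmod w).
have [u hu] := disc_shift w t ltac:(lra).
have e : t = u - w by rewrite hu; ring.
rewrite /germ_at -hu disc_extE e; apply: h; rewrite -e; lra.
Qed.

Lemma germ_at_sub f w z : germ_at f w (disc_val z - disc_val w) = f z.
Proof.
rewrite /germ_at; have -> : w + (z - w) = z by ring.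
exact: disc_extE.
Qed.

Lemma analytic_const c : analytic (fun _ => c).
Proof.
apply/analyticP => w; apply: (germ_at_ext _ _ _ 1 Rlt_0_1) (germ_const c).
by [].
Qed.

Lemma analytic_id : analytic (fun z => z : C).
Proof.
apply/analyticP => w.
apply: (germ_at_ext _ _ _ 1 Rlt_0_1) (germ_plus _ _ (germ_const w) germ_id).
by move=> z _; ring.
Qed.

Lemma analytic_plus f g : analytic f -> analytic g -> analytic (fun z => f z + g z).
Proof.
move=> /analyticP hf /analyticP hg; apply/analyticP => w.
apply: (germ_at_ext _ _ _ 1 Rlt_0_1) (germ_plus _ _ (hf w) (hg w)).
by move=> z _; rewrite !germ_at_sub.
Qed.

Lemma analytic_mult f g : analytic f -> analytic g -> analytic (fun z => f z * g z).
Proof.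
move=> /analyticP hf /analyticP hg; apply/analyticP => w.
apply: (germ_at_ext _ _ _ 1 Rlt_0_1) (germ_mult _ _ (hf w) (hg w)).
by move=> z _; rewrite !germ_at_sub.
Qed.

Lemma analytic_ext f g : (forall z, f z = g z) -> analytic f -> analytic g.
Proof. by move=> /functional_extensionality ->. Qed.

Lemma analytic_scal c f : analytic f -> analytic (fun z => c * f z).
Proof. exact: analytic_mult (analytic_const c). Qed.

Lemma analytic_minus f g : analytic f -> analytic g -> analytic (fun z => f z - g z).
Proof.
move=> hf hg; apply: (analytic_ext (fun z => f z + (-(1)) * g z)).
  by move=> z; ring.
exact: analytic_plus hf (analytic_scal _ _ hg).
Qed.

Lemma analytic_pow f n : analytic f -> analytic (fun z => f z ^ n).
Proof.
move=> hf; elim: n => [|n IH]; first exact: analytic_const.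
exact: analytic_mult.
Qed.

Lemma analytic_inv f : (forall z, f z <> 0) -> analytic f -> analytic (fun z => / f z).
Proof.
move=> h /analyticP hf; apply/analyticP => w.
have hw : germ_at f w 0 <> 0 by rewrite germ_at0; apply: h.
apply: (germ_at_ext _ _ _ 1 Rlt_0_1) (germ_inv _ (hf w) hw).
by move=> z _; rewrite germ_at_sub.
Qed.

Lemma analytic_comp f (phi : unit_disc -> unit_disc) :
  analytic f -> analytic_self_map phi -> analytic (fun z => f (phi z)).
Proof.
move=> /analyticP hf /analyticP hphi; apply/analyticP => w.
have hG : germ_analytic (fun t => germ_at (fun z => phi z : C) w t + - phi w).
  exact: germ_plus (hphi w) (germ_const _).
have h0 : germ_at (fun z => phi z : C) w 0 + - phi w = 0.
  by rewrite germ_at0; ring.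
apply: (germ_at_ext _ _ _ 1 Rlt_0_1) (germ_comp _ _ (hf (phi w)) hG h0).
by move=> z _; rewrite germ_at_sub -/(Cminus (phi z) (phi w)) germ_at_sub.
Qed.

(** * Neighbourhoods, continuity and limits *)

Definition near (w : unit_disc) (P : unit_disc -> Prop) : Prop :=
  exists d : R, (0 < d)%R /\ forall z : unit_disc, (Cmod (z - w) < d)%R -> P z.

Lemma near_and w (P Q : unit_disc -> Prop) :
  near w P -> near w Q -> near w (fun z => P z /\ Q z).
Proof.
move=> [d [hd h]] [d' [hd' h']]; exists (Rmin d d').
have h1 := Rmin_l d d'; have h2 := Rmin_r d d'.
split; first by apply: Rmin_glb_lt.
by move=> z hz; split; [apply: h | apply: h']; lra.
Qed.

Lemma near_imp w (P Q : unit_disc -> Prop) :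
  (forall z, P z -> Q z) -> near w P -> near w Q.
Proof. by move=> h [d [hd hP]]; exists d; split=> // z /hP /h. Qed.

Lemma near_self w (P : unit_disc -> Prop) : near w P -> P w.
Proof.
move=> [d [hd h]]; apply: h; have -> : w - w = 0 by ring.
by rewrite Cmod_0.
Qed.

Lemma near_pick w (P : unit_disc -> Prop) :
  near w P -> exists z, z <> w /\ P z.
Proof.
move=> [d [hd h]]; have hw := disc_lt1 w.
set x := (Rmin d (1 - Cmod w) / 2)%R.
have h1 := Rmin_l d (1 - Cmod w); have h2 := Rmin_r d (1 - Cmod w).
have h3 : (0 < Rmin d (1 - Cmod w))%R by apply: Rmin_glb_lt; lra.
have hx : Cmod x = x by apply: Cmod_Rpos; rewrite /x; lra.
have [u hu] := disc_shift w x ltac:(rewrite hx /x; lra).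
have e : u - w = x by rewrite hu; ring.
exists u; split.
  move=> euw; move: e; rewrite euw; have -> : w - w = 0 by ring.
  move=> e; move: hx; rewrite -e Cmod_0 /x; lra.
by apply: h; rewrite e hx /x; lra.
Qed.

Definition cont_at (f : unit_disc -> C) (w : unit_disc) : Prop :=
  forall eps : R, (0 < eps)%R -> near w (fun z => (Cmod (f z - f w) < eps)%R).

Lemma cont_const c w : cont_at (fun _ => c) w.
Proof.
move=> eps he; exists 1%R; split; first by lra.
by move=> z _; rewrite (_ : c - c = 0) ?Cmod_0 //; ring.
Qed.

Lemma cont_id w : cont_at (fun z => z : C) w.
Proof. by move=> eps he; exists eps. Qed.

Lemma cont_plus f g w : cont_at f w -> cont_at g w -> cont_at (fun z => f z + g z) w.
Proof.
move=> hf hg eps he.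
apply: near_imp (near_and _ _ _ (hf (eps/2)%R ltac:(lra)) (hg (eps/2)%R ltac:(lra))).
move=> z [h1 h2].
have -> : f z + g z - (f w + g w) = (f z - f w) + (g z - g w) by ring.
apply: Rle_lt_trans (Cmod_triangle _ _) _; lra.
Qed.

Lemma cont_mult f g w : cont_at f w -> cont_at g w -> cont_at (fun z => f z * g z) w.
Proof.
move=> hf hg eps he.
set A := Cmod (f w); set B := Cmod (g w).
have hA : (0 <= A)%R by apply: Cmod_ge_0.
have hB : (0 <= B)%R by apply: Cmod_ge_0.
have hp : (0 < eps / (2 * (A + B + 1)))%R by apply: Rdiv_lt_0_compat; lra.
set e1 := (eps / (2 * (A + B + 1)))%R in hp.
have e1E : (e1 * (A + B + 1) = eps / 2)%R by rewrite /e1; field; lra.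
have hmin : (0 < Rmin e1 1)%R by apply: Rmin_glb_lt; lra.
have hl := Rmin_l e1 1; have hr := Rmin_r e1 1.
apply: near_imp (near_and _ _ _ (hf _ hmin) (hg _ hmin)) => z [h1 h2].
have -> : f z * g z - f w * g w =
  (f z - f w) * (g z - g w) + f w * (g z - g w) + g w * (f z - f w) by ring.
apply: Rle_lt_trans (Cmod_triangle _ _) _; rewrite Cmod_mult -/B.
have := Cmod_triangle ((f z - f w) * (g z - g w)) (f w * (g z - g w)).
rewrite !Cmod_mult -/A => h3.
have p1 := Cmod_ge_0 (f z - f w); have p2 := Cmod_ge_0 (g z - g w).
set X := Cmod (f z - f w) in h1 h3 p1 *; set Y := Cmod (g z - g w) in h2 h3 p2 *.
have : (X * Y <= e1 * 1)%R by apply: Rmult_le_compat; lra.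
have : (A * Y <= A * e1)%R by apply: Rmult_le_compat_l; lra.
have : (B * X <= B * e1)%R by apply: Rmult_le_compat_l; lra.
lra.
Qed.

Lemma cont_nonzero f w : cont_at f w -> f w <> 0 ->
  near w (fun z => (Cmod (f w) / 2 < Cmod (f z))%R).
Proof.
move=> hf h0; have hp := Cmod_pos _ h0.
apply: near_imp (hf (Cmod (f w) / 2)%R ltac:(lra)) => z hz.
rewrite Cmod_minus_sym in hz; have := Cmod_triangle_rev (f w) (f z); lra.
Qed.

Lemma cont_inv f w : cont_at f w -> f w <> 0 -> cont_at (fun z => / f z) w.
Proof.
move=> hf h0 eps he; have hp := Cmod_pos _ h0.
set A := Cmod (f w) in hp.
have he1 : (0 < eps * (A * A / 2))%R by apply: Rmult_lt_0_compat => //; nra.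
apply: near_imp (near_and _ _ _ (cont_nonzero _ _ hf h0) (hf _ he1)) => z [h1 h2].
rewrite -/A in h1.
have hz : f z <> 0 by apply: Cmod_ne0; lra.
have -> : / f z - / f w = - (f z - f w) * / (f z * f w) by field.
have hzw : f z * f w <> 0 by apply: Cmult_neq_0.
rewrite Cmod_mult Cmod_opp Cmod_inv // Cmod_mult -/A.
apply: (Rmult_lt_reg_r (Cmod (f z) * A)); first by nra.
rewrite Rmult_assoc Rinv_l; last by nra.
rewrite Rmult_1_r; apply: Rlt_le_trans h2 _.
apply: Rmult_le_compat_l; first by lra.
nra.
Qed.

Lemma cont_pow f w n : cont_at f w -> cont_at (fun z => f z ^ n) w.
Proof.
move=> hf; elim: n => [|n IH]; first exact: cont_const.
exact: cont_mult.
Qed.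

Lemma cont_minus f g w : cont_at f w -> cont_at g w -> cont_at (fun z => f z - g z) w.
Proof.
move=> hf hg eps he.
have h := cont_plus _ _ _ hf (cont_mult _ _ _ (cont_const (-(1)) w) hg) eps he.
apply: near_imp h => z; congr Rlt; congr Cmod; ring.
Qed.

Definition disc_cont_at (phi : unit_disc -> unit_disc) (w : unit_disc) : Prop :=
  cont_at (fun z => phi z : C) w.

Lemma near_comp (phi : unit_disc -> unit_disc) w (P : unit_disc -> Prop) :
  disc_cont_at phi w -> near (phi w) P -> near w (fun z => P (phi z)).
Proof. by move=> hphi [d [hd h]]; apply: near_imp (hphi d hd) => z; apply: h. Qed.

Lemma cont_comp f (phi : unit_disc -> unit_disc) w :
  cont_at f (phi w) -> disc_cont_at phi w -> cont_at (fun z => f (phi z)) w.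
Proof. by move=> hf hphi eps he; apply: near_comp hphi (hf eps he). Qed.

Lemma analytic_cont f w : analytic f -> cont_at f w.
Proof.
move=> /analyticP /(_ w) [a [r [hr h]]] eps he.
have [M [hM HM]] := ps_coef_bound a r _ hr h (r/2) ltac:(lra).
(* The tail of the series from index 1 is at most [2 M q] with [q = 2 |t| / r], that is
   [4 M |t| / r]. *)
have hp : (0 < eps * r / (4 * (M + 1)))%R by apply: Rdiv_lt_0_compat; nra.
set e1 := (eps * r / (4 * (M + 1)))%R in hp.
have e1E : (e1 * (4 * (M + 1)) = eps * r)%R by rewrite /e1; field; lra.
exists (Rmin e1 (r / 4)); split; first by apply: Rmin_glb_lt; lra.
move=> z hz.
have hl := Rmin_l e1 (r / 4); have hr' := Rmin_r e1 (r / 4).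
have hser : is_ps a (z - w) (f z) by rewrite -(germ_at_sub f w); apply: h; lra.
have h0 : a 0%nat = f w.
  rewrite -(germ_at0 f w); apply: is_cseries_uniq (is_ps_0 a) _; apply: h.
  by rewrite Cmod_0.
have := proj2 (is_cseries_shift _ _ 0) hser.
rewrite csum_0 /= h0.
have -> : f z - 1 * f w = f z - f w by ring.
set t := z - w in hz hser *; have ht := Cmod_ge_0 t.
move=> hs.
have hq : (0 <= Cmod t * 2 / r <= 1/2)%R.
  split; first by apply: Rmult_le_pos; [lra | apply/Rlt_le/Rinv_0_lt_compat].
  apply: (Rmult_le_reg_r r) => //.
  have -> : (Cmod t * 2 / r * r = Cmod t * 2)%R by field; lra.
  lra.
have e : (Cmod t = r / 2 * (Cmod t * 2 / r))%R by field; lra.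
set q := (Cmod t * 2 / r)%R in hq e.
apply: Rle_lt_trans (is_cseries_half_le _ _ (M * q)%R _ hs _) _.
- nra.
- move=> n; rewrite -Cpow_S Cmod_mult Cmod_pow {1}e Rpow_mult_distr.
  have h1 := HM (S n).
  have hqn : (0 <= q ^ n)%R by apply: pow_le; lra.
  have hqn' : (q ^ n <= (1/2) ^ n)%R by apply: pow_incr; lra.
  have hqq : (q * q ^ n <= q * (1/2) ^ n)%R by apply: Rmult_le_compat_l; lra.
  have hq0 : (0 <= q * q ^ n)%R by nra.
  have := Rmult_le_compat_r _ _ _ hq0 h1.
  have := Rmult_le_compat_l _ _ _ hM hqq.
  rewrite /=; lra.
- apply: (Rmult_lt_reg_r r) => //.
  have -> : (2 * (M * q) * r = 4 * M * Cmod t)%R by rewrite e; field; lra.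
  rewrite -e1E; nra.
Qed.

Lemma lim_uniq u v w : cont_at u w -> cont_at v w ->
  near w (fun z => z <> w -> u z = v z) -> u w = v w.
Proof.
move=> hu hv h; apply: NNPP => hne.
have hd : (0 < Cmod (u w - v w))%R.
  by apply: Cmod_pos => e; apply: hne; rewrite -(Cplus_0_r (v w)) -e; ring.
set e := Cmod (u w - v w) in hd.
have [z [hz [[h1 h2] h3]]] := near_pick _ _
  (near_and _ _ _ (near_and _ _ _ (hu (e/2)%R ltac:(lra)) (hv (e/2)%R ltac:(lra))) h).
rewrite (h3 hz) Cmod_minus_sym in h1.
have := Cmod_triangle (u w - v z) (v z - v w).
have -> : u w - v z + (v z - v w) = u w - v w by ring.
rewrite -/e; lra.
Qed.

Lemma lim_le u v w : cont_at u w -> cont_at v w ->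
  near w (fun z => z <> w -> (Cmod (u z) <= Cmod (v z))%R) ->
  (Cmod (u w) <= Cmod (v w))%R.
Proof.
move=> hu hv h; apply: Rnot_lt_le => hlt.
set e := (Cmod (u w) - Cmod (v w))%R.
have he : (0 < e / 2)%R by rewrite /e; lra.
have [z [hz [[h1 h2] h3]]] := near_pick _ _
  (near_and _ _ _ (near_and _ _ _ (hu _ he) (hv _ he)) h).
have h4 := h3 hz.
rewrite Cmod_minus_sym in h1.
have h5 := Cmod_triangle_rev (u w) (u z).
have h6 := Cmod_triangle_rev (v z) (v w).
rewrite /e in h1 h2; lra.
Qed.

(** * Order of vanishing and division by powers of z - w *)

Lemma disc_sub_ne0 (z w : unit_disc) : z <> w -> z - w <> 0.
Proof.
move=> h e; apply: h; apply: disc_eq.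
by rewrite -(Cplus_0_r w) -e; ring.
Qed.

(** Continuity of the cofactor at [w] already makes n unique, and it passes to products and
    compositions without a return to power series. *)
Definition has_order (f : unit_disc -> C) (w : unit_disc) (n : nat) : Prop :=
  exists u, cont_at u w /\ u w <> 0 /\ forall z : unit_disc, f z = (z - w) ^ n * u z.

(** If n < m, cancelling [(z - w) ^ n] off w gives [u = (z - w) ^ (m - n) * v] there, and continuity
    forces [u w = 0]. *)
Lemma order_le f w n m u v : cont_at u w -> u w <> 0 -> cont_at v w ->
  (forall z : unit_disc, f z = (z - w) ^ n * u z) ->
  (forall z : unit_disc, f z = (z - w) ^ m * v z) -> (m <= n)%nat.
Proof.
move=> hu hu0 hv eu ev.
case: (le_lt_dec m n) => // hlt; case: hu0.
have hpow : cont_at (fun z => (z - w) ^ (m - n) * v z) w.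
  apply: cont_mult hv; apply: cont_pow; apply: cont_minus; last exact: cont_const.
  exact: cont_id.
rewrite (lim_uniq u _ w hu hpow).
  have -> : (m - n = S (m - n - 1))%nat by lia.
  by rewrite Cpow_S; ring.
exists 1%R; split; first by lra.
move=> z _ hz; have hzw := Cpow_nz _ n (disc_sub_ne0 _ _ hz).
have e : (z - w) ^ n * u z = (z - w) ^ n * ((z - w) ^ (m - n) * v z).
  rewrite Cmult_assoc -Cpow_add_r; have -> : (n + (m - n) = m)%nat by lia.
  by rewrite -eu ev.
have -> : u z = (z - w) ^ n * u z / (z - w) ^ n by field.
by rewrite e; field.
Qed.

Lemma has_order_uniq f w n m : has_order f w n -> has_order f w m -> n = m.
Proof.
move=> [u [hu [hu0 eu]]] [v [hv [hv0 ev]]].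
have h1 := order_le f w n m u v hu hu0 hv eu ev.
have h2 := order_le f w m n v u hv hv0 hu ev eu.
by lia.
Qed.

Lemma has_order_mult f g w n m :
  has_order f w n -> has_order g w m -> has_order (fun z => f z * g z) w (n + m).
Proof.
move=> [u [hu [hu0 eu]]] [v [hv [hv0 ev]]].
exists (fun z => u z * v z); split; first exact: cont_mult.
split; first exact: Cmult_neq_0.
by move=> z; rewrite eu ev Cpow_add_r; ring.
Qed.

Lemma has_order_comp f (phi : unit_disc -> unit_disc) w k m :
  disc_cont_at phi w ->
  has_order f (phi w) m -> has_order (fun z => phi z - phi w) w k ->
  has_order (fun z => f (phi z)) w (k * m).
Proof.
move=> hphi [u [hu [hu0 eu]]] [v [hv [hv0 ev]]].
exists (fun z => v z ^ m * u (phi z)); split.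
  by apply: cont_mult; [apply: cont_pow | apply: cont_comp].
split; first by apply: Cmult_neq_0 => //; apply: Cpow_nz.
by move=> z; rewrite eu ev Cpow_mult_l Cpow_mult_r; ring.
Qed.

Lemma has_order_0 f w : cont_at f w -> f w <> 0 -> has_order f w 0.
Proof. by move=> hf h0; exists f; do 2!split=> //; move=> z /=; ring. Qed.

Lemma has_order_gt0 f w n : has_order f w n -> f w = 0 -> (0 < n)%nat.
Proof.
case: n => [|n] [u [_ [hu e]]] h; last by lia.
by case: hu; rewrite -h e /=; ring.
Qed.

Lemma has_order_zero f w n : has_order f w n -> (0 < n)%nat -> f w = 0.
Proof.
case: n => [|n] [u [_ [hu e]]] h; first by lia.
by rewrite e Cpow_S; ring.
Qed.

Lemma has_order_near f w n :
  has_order f w n -> near w (fun z => z <> w -> f z <> 0).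
Proof.
move=> [u [hu [hu0 e]]].
apply: near_imp (cont_nonzero _ _ hu hu0) => z hz hzw.
have hp := Cmod_pos _ hu0.
rewrite e; apply: Cmult_neq_0; first exact/Cpow_nz/disc_sub_ne0.
apply: Cmod_ne0; lra.
Qed.

Lemma has_order_nonzero f w n : has_order f w n -> ~ near w (fun z => f z = 0).
Proof.
move=> h h'.
by have [z [hz [h1 h2]]] := near_pick _ _ (near_and _ _ _ (has_order_near _ _ _ h) h'); apply: h1.
Qed.

(** At w the quotient has the shifted series. At another point w' it is f times an inverted germ;
    this is valid in the ball of radius |w' - w|, which misses w and so the exceptional value of
    [g]. *)
Lemma analytic_factor f w a n : analytic f -> power_series_at f w a ->
  (forall k, (k < n)%nat -> a k = 0) ->
  exists g, analytic g /\ g w = a n /\ forall z : unit_disc, f z = (z - w) ^ n * g z.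
Proof.
move=> hf /power_series_atP [r [hr ha]] hk.
pose g (z : unit_disc) : C :=
  match excluded_middle_informative (z = w) with
  | left _ => a n
  | right _ => f z / (z - w) ^ n
  end.
have gw : g w = a n by rewrite /g; case: excluded_middle_informative.
have gz z : z <> w -> g z = f z / (z - w) ^ n.
  by move=> h; rewrite /g; case: excluded_middle_informative.
have hzn (z : unit_disc) : z <> w -> (z - w) ^ n <> 0.
  by move=> h; apply/Cpow_nz/disc_sub_ne0.
have hps z : (Cmod (z - w) < r)%R -> is_ps (fun k => a (n + k)%nat) (disc_val z - w) (g z).
  move=> hz; case: (classic (z = w)) => [->|hne].
    have -> : w - w = 0 by ring.
    rewrite gw; have := is_ps_0 (fun k => a (n + k)%nat).
    by rewrite Nat.add_0_r.
  rewrite gz //; have := ha _ hz; rewrite germ_at_sub => hs.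
  set t := z - w in hs *; have ht : t ^ n <> 0 by apply: hzn.
  have hs' : is_cseries (fun k => t ^ (n + k) * a (n + k)%nat) (f z).
    case: n hk {g gw gz hzn ht} => [|n] hk; first exact: hs.
    have := proj2 (is_cseries_shift _ _ n) hs.
    have -> : csum (fun k => t ^ k * a k) n = 0.
      rewrite (csum_ext _ (fun k => 0 * 0)) ?csum_scal; first by ring.
      by move=> k hk'; rewrite hk; [ring | lia].
    have -> : f z - 0 = f z by ring.
    by apply: is_cseries_ext => k; rewrite Nat.add_succ_r.
  have := is_cseries_scal (/ t ^ n) _ _ hs'.
  have -> : / t ^ n * f z = f z / t ^ n by rewrite Cmult_comm.
  by apply: is_cseries_ext => k; rewrite Cpow_add_r; field.
exists g; split; last split=> //; last first.
  move=> z; case: (classic (z = w)) => [->|hne]; last first.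
    by rewrite gz //; field; apply: hzn.
  rewrite gw.
  have h0 : is_ps a 0 (f w) by rewrite -(germ_at0 f w); apply: ha; rewrite Cmod_0.
  rewrite (is_cseries_uniq _ _ _ h0 (is_ps_0 a)).
  have -> : w - w = 0 by ring.
  case: n hk {g gw gz hzn hps} => [|n] hk /=; first by ring.
  by rewrite hk; [ring | lia].
apply/analyticP => w'; case: (classic (w' = w)) => [->|hne].
  exists (fun k => a (n + k)%nat).
  by apply/power_series_atP; exists r; split=> // z hz; apply: hps.
have hd := Cmod_pos _ (disc_sub_ne0 _ _ hne).
have hpow : germ_analytic (fun t => / germ_at (fun z => (z - w) ^ n) w' t).
  apply: germ_inv; last by rewrite germ_at0; apply: hzn.
  move: w' {hne hd}; apply/analyticP; apply: analytic_pow; apply: analytic_minus.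
    exact: analytic_id.
  exact: analytic_const.
apply: (germ_at_ext _ _ _ _ hd) (germ_mult _ _ (proj1 (analyticP f) hf w') hpow).
move=> z hz; rewrite !germ_at_sub gz // => e.
by move: hz; rewrite e Cmod_minus_sym; lra.
Qed.

Lemma power_series_zero f w (a : nat -> C) :
  power_series_at f w a -> (forall k, a k = 0) -> near w (fun z => f z = 0).
Proof.
move=> [r [hr h]] h0; exists r; split=> // z hz.
have hs : is_ps a (z - w) (f z) := h z hz.
apply: is_cseries_uniq hs _.
have e : csum (fun k => (z - w) ^ k * a k) 0 = 0 by rewrite csum_0 h0; ring.
rewrite -[X in is_cseries _ X]e.
by apply: (is_cseries_finite (fun k => (z - w) ^ k * a k)) => k _; rewrite h0; ring.
Qed.

Lemma analytic_order f w : analytic f ->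
  near w (fun z => f z = 0) \/
  exists n g, analytic g /\ g w <> 0 /\ forall z : unit_disc, f z = (z - w) ^ n * g z.
Proof.
move=> hf; have [a ha] := hf w.
case: (classic (exists n, a n <> 0)) => [hn|hn]; last first.
  left; apply: (power_series_zero _ _ _ ha) => k.
  exact: NNPP _ (not_ex_all_not _ _ hn k).
right.
have [n [hn0 hmin]] : exists n, a n <> 0 /\ forall k, (k < n)%nat -> a k = 0.
  case: hn => n; elim/lt_wf_ind: n => n IH hn.
  case: (classic (exists k, (k < n)%nat /\ a k <> 0)) => [[k [hk hk0]]|h].
    exact: IH hk hk0.
  by exists n; split=> // k hk; apply: NNPP => h'; apply: h; exists k.
have [g [hg [gw e]]] := analytic_factor f w a n hf ha hmin.
by exists n, g; rewrite gw.
Qed.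

Lemma analytic_has_order f w : analytic f ->
  near w (fun z => f z = 0) \/ exists n, has_order f w n.
Proof.
move=> hf; case: (analytic_order f w hf) => [h|[n [g [hg [g0 e]]]]]; first by left.
by right; exists n, g; split; first exact: analytic_cont.
Qed.

Lemma vanishing_order_has_order f w n : analytic f ->
  vanishing_order f w n -> has_order f w n.
Proof.
move=> hf [a [ha [hk hn]]].
have [g [hg [gw e]]] := analytic_factor f w a n hf ha hk.
by exists g; split; [apply: analytic_cont | rewrite gw].
Qed.

(** The coefficients cannot all vanish, since f has no zeros near w other than w; the first nonzero
    index is an order of f, hence equals n. *)
Lemma has_order_vanishing_order f w n : analytic f ->
  has_order f w n -> vanishing_order f w n.
Proof.
move=> hf h; have [a ha] := hf w.
have hex : exists m, (a m <> 0) /\ forall k, (k < m)%nat -> a k = 0.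
  apply: NNPP => hno.
  have h0 k : a k = 0.
    elim/lt_wf_ind: k => k IH; apply: NNPP => hk; apply: hno.
    by exists k; split.
  apply: (has_order_nonzero _ _ _ h).
  exact: power_series_zero ha h0.
have [m [hm hk]] := hex.
have hv : vanishing_order f w m by exists a.
by rewrite (has_order_uniq _ _ _ _ h (vanishing_order_has_order _ _ _ hf hv)).
Qed.

Lemma multiplicity_has_order f w n : analytic f ->
  has_order f w n -> multiplicity f w = n.
Proof.
move=> hf h.
have hv : vanishing_order f w (multiplicity f w).
  by apply: epsilon_spec; exists n; apply: has_order_vanishing_order.
exact: has_order_uniq (vanishing_order_has_order _ _ _ hf hv) h.
Qed.

(** * Identity theorem and maximum principle *)

Lemma Csub_diag (x : C) : x - x = 0.
Proof. by ring. Qed.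

Lemma near_near w (P : unit_disc -> Prop) : near w P -> near w (fun z => near z P).
Proof.
move=> [d [hd h]]; exists d; split=> // z hz.
exists (d - Cmod (z - w))%R; split; first by lra.
move=> z' hz'; apply: h.
have -> : z' - w = (z' - z) + (z - w) by ring.
apply: Rle_lt_trans (Cmod_triangle _ _) _; lra.
Qed.

Lemma segment_disc (a b : unit_disc) (t : R) : (0 <= t <= 1)%R ->
  exists w, (w : C) = a + t * (b - a).
Proof.
move=> ht; apply: disc_of.
have -> : a + t * (b - a) = RtoC (1 - t) * a + t * b by rewrite RtoC_minus; ring.
apply: Rle_lt_trans (Cmod_triangle _ _) _.
rewrite !Cmod_mult !Cmod_Rpos; try lra.
have ha := disc_lt1 a; have hb := disc_lt1 b.
case: (Req_dec t 1) => [->|h1]; first by lra.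
have : (0 < (1 - t) * (1 - Cmod a))%R by apply: Rmult_lt_0_compat; lra.
have : (0 <= t * (1 - Cmod b))%R by apply: Rmult_le_pos; lra.
lra.
Qed.

(** Continuation along the segment from a to b. At the supremum s of the parameters reached, f has
    zeros arbitrarily close to the point, so a finite order is excluded unless f already vanishes
    around it; local vanishing there pushes past s unless s = 1. *)
Lemma identity_theorem f (a : unit_disc) : analytic f -> near a (fun z => f z = 0) ->
  forall z, f z = 0.
Proof.
move=> hf ha b.
case: (classic (b = a)) => [->|hba]; first exact: near_self ha.
have hD := Cmod_pos _ (disc_sub_ne0 _ _ hba).
set D := Cmod (b - a) in hD.
pose P (t : R) := exists w, (w : C) = a + t * (b - a) /\ near w (fun z => f z = 0).
pose E (t : R) := (0 <= t <= 1)%R /\ forall s, (0 <= s <= t)%R -> P s.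
have E0 : E 0%R.
  split; first by lra.
  move=> s hs; have -> : s = 0%R by lra.
  by exists a; split=> //; ring.
have [s [hub hlub]] : { s : R | is_lub E s }.
  by apply: completeness; [exists 1%R => t [ht _]; lra | exists 0%R].
have hs0 : (0 <= s)%R by apply: hub.
have hs1 : (s <= 1)%R by apply: hlub => t [ht _]; lra.
have [w hw] := segment_disc a b s (conj hs0 hs1).
have hdist (t : R) z : (z : C) = a + t * (b - a) -> Cmod (z - w) = (Rabs (t - s) * D)%R.
  move=> hz; rewrite -Cmod_R -Cmod_mult hz hw RtoC_minus; congr Cmod; ring.
have happ (d : R) : (0 < d)%R -> exists t, E t /\ (s - d < t <= s)%R.
  move=> hd; apply: NNPP => hno.
  have : (s <= s - d)%R; last by lra.
  apply: hlub => t ht; apply: Rnot_lt_le => hlt; apply: hno; exists t.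
  by split=> //; have := hub t ht; lra.
have hnear : near w (fun z => f z = 0).
  case: (analytic_has_order f w hf) => // [[n hn]].
  have [d [hd h]] := has_order_near _ _ _ hn.
  have hdD : (0 < d / D)%R by apply: Rdiv_lt_0_compat.
  have [t [[ht0 ht] htl]] := happ _ hdD.
  have [z [hz hzn]] := ht t ltac:(lra).
  case: (classic (z = w)) => [e|hne]; first by rewrite -e.
  case: (h z _ hne (near_self _ _ hzn)).
  rewrite (hdist _ _ hz) Rabs_left1; last by lra.
  have : ((s - t) * D < d / D * D)%R by apply: Rmult_lt_compat_r; lra.
  have -> : (d / D * D = d)%R by field; lra.
  lra.
have [d [hd h]] := near_near _ _ hnear.
have hdD : (0 < d / D)%R by apply: Rdiv_lt_0_compat.
case: (Req_dec s 1) => hs.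
  have -> : b = w by apply: disc_eq; rewrite hw hs; ring.
  exact: near_self hnear.
have hE : E (Rmin 1 (s + d / (2 * D))).
  have h1 := Rmin_l 1 (s + d / (2 * D)); have h2 := Rmin_r 1 (s + d / (2 * D)).
  have hd2 : (d / (2 * D) = d / D / 2)%R by field; lra.
  split; first by split=> //; apply: Rmin_glb; lra.
  move=> t ht; case: (Rlt_le_dec t s) => hts.
    have [t' [[_ ht'] hl]] := happ (s - t)%R ltac:(lra).
    by apply: ht'; lra.
  have [z hz] := segment_disc a b t ltac:(lra).
  exists z; split=> //; apply: h.
  rewrite (hdist _ _ hz) Rabs_pos_eq; last by lra.
  have : ((t - s) * D <= d / D / 2 * D)%R by apply: Rmult_le_compat_r; lra.
  have -> : (d / D / 2 * D = d / 2)%R by field; lra.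
  lra.
have hc := hub _ hE.
have : (s < Rmin 1 (s + d / (2 * D)))%R; last by lra.
apply: Rmin_glb_lt; first by lra.
have : (0 < d / (2 * D))%R by apply: Rdiv_lt_0_compat; lra.
lra.
Qed.

Lemma analytic_has_order_of_neq f (c : C) w z : analytic f -> f z <> c ->
  exists n, has_order (fun z => f z - c) w n.
Proof.
move=> hf hz; have ha := analytic_minus _ _ hf (analytic_const c).
case: (analytic_has_order _ w ha) => // h.
case: hz; have e := identity_theorem _ _ ha h z.
by rewrite -(Cplus_0_r c) -e; ring.
Qed.

(** * Roots of unimodular numbers and radial perturbation *)

Definition cis (t : R) : C := (cos t, sin t).

Lemma cis_pow t n : cis t ^ n = cis (INR n * t).
Proof.
elim: n => [|n IH]; first by rewrite /= /cis Rmult_0_l cos_0 sin_0.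
have -> : (INR (S n) * t = t + INR n * t)%R by rewrite S_INR; ring.
by rewrite Cpow_S IH /cis cos_plus sin_plus /Cmult /=; congr pair; ring.
Qed.

Lemma Cmod_cis t : Cmod (cis t) = 1%R.
Proof.
rewrite /Cmod /cis [fst _]/= [snd _]/=.
have h := sin2_cos2 t; rewrite /Rsqr in h.
have -> : (cos t ^ 2 + sin t ^ 2 = 1)%R by lra.
exact: sqrt_1.
Qed.

Lemma unimodular_cis (c : C) : Cmod c = 1%R -> exists t, c = cis t.
Proof.
move=> hc; have := Cmod2_alt c; rewrite hc; case: c {hc} => x y /=.
rewrite /Re /Im /= => h.
have hx : (-1 <= x <= 1)%R by nra.
have hcos := cos_acos x hx.
have hsin : (Rsqr (sin (acos x)) = Rsqr y)%R.
  by have := sin2_cos2 (acos x); rewrite hcos /Rsqr; nra.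
case: (Rsqr_eq _ _ hsin) => e.
  by exists (acos x); rewrite /cis hcos e.
by exists (- acos x)%R; rewrite /cis cos_neg sin_neg hcos e Ropp_involutive.
Qed.

Lemma unimodular_root (c : C) n : Cmod c = 1%R -> (0 < n)%nat ->
  exists e, Cmod e = 1%R /\ e ^ n = c.
Proof.
move=> hc hn; have [t ->] := unimodular_cis c hc.
exists (cis (t / INR n)); split; first exact: Cmod_cis.
rewrite cis_pow; congr cis; field.
by apply: not_0_INR; lia.
Qed.

(* The displacement [s e] is chosen so that [(s e)^n u w] is the multiple
   [q s^n |u w| / |c|] of [c]. *)
Lemma perturbation_direction u w (c q : C) n (d : R) :
  cont_at u w -> u w <> 0 -> c <> 0 -> Cmod q = 1%R -> (0 < n)%nat -> (0 < d)%R ->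
  exists z (x : R), z <> w /\ (Cmod (z - w) < d)%R /\ (0 < x <= Cmod c)%R /\
    (Cmod (c + (z - w) ^ n * u z - c * (1 + q * (x / Cmod c)%R)) <= x / 2)%R.
Proof.
move=> hu hu0 hc hq hn hd.
have pc := Cmod_pos _ hc; have pu := Cmod_pos _ hu0.
set A := Cmod c in pc *; set U := Cmod (u w) in pu.
have [e [he1 hen]] : exists e, Cmod e = 1%R /\ e ^ n = q * c * RtoC U / (RtoC A * u w).
  apply: unimodular_root => //.
  have hAu : RtoC A * u w <> 0.
    by apply: Cmult_neq_0 => //; apply: Cmod_ne0; rewrite Cmod_Rpos; lra.
  rewrite Cmod_div // !Cmod_mult hq !Cmod_Rpos -/A -/U; try lra.
  by field; lra.
have hU2 : (0 < U / 2)%R by lra.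
have [d' [hd' h']] := hu _ hU2.
have hw := disc_lt1 w.
have hAU : (0 < A / U)%R by apply: Rdiv_lt_0_compat.
(* The step s is below each entry: s < 1 gives [s ^ n <= s], then s < A/U gives [s ^ n * U <= A],
   and d' keeps u within U/2 of [u w], so that the error is at most half of [s ^ n * U]. *)
set m := Rmin (Rmin d d') (Rmin (1 - Cmod w) (Rmin 1 (A / U))).
have hm : (0 < m)%R by do ![apply: Rmin_glb_lt]; lra.
have m1 : (m <= Rmin d d')%R by apply: Rmin_l.
have m2 : (m <= Rmin (1 - Cmod w) (Rmin 1 (A / U)))%R by apply: Rmin_r.
have := Rmin_l d d'; have := Rmin_r d d'.
have := Rmin_l (1 - Cmod w) (Rmin 1 (A / U)); have := Rmin_r (1 - Cmod w) (Rmin 1 (A / U)).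
have := Rmin_l 1 (A / U); have := Rmin_r 1 (A / U) => k1 k2 k3 k4 k5 k6.
set s := (m / 2)%R; have hs : (0 < s)%R by rewrite /s; lra.
have hsm : (s < m)%R by rewrite /s; lra.
have hse : Cmod (s * e) = s by rewrite Cmod_mult he1 Cmod_Rpos; lra.
have [z hz] := disc_shift w (s * e) ltac:(rewrite hse; lra).
have ez : z - w = s * e by rewrite hz; ring.
have hsn : (0 < s ^ n)%R by apply: pow_lt.
have hsn1 : (s ^ n <= s)%R.
  have -> : n = S (n - 1) by lia.
  have : (s ^ (n - 1) <= 1 ^ (n - 1))%R by apply: pow_incr; lra.
  rewrite pow1 /=; nra.
exists z, (s ^ n * U)%R; split.
  move=> e'; move: ez; rewrite e' => e''.
  move: hse; rewrite -e''; have -> : w - w = 0 by ring.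
  rewrite Cmod_0; lra.
split; first by rewrite ez hse; lra.
split.
  split; first by apply: Rmult_lt_0_compat.
  have : (s ^ n * U <= A / U * U)%R by apply: Rmult_le_compat_r; lra.
  by have -> : (A / U * U = A)%R by field; lra.
have hAC : RtoC A <> 0 by apply: Cmod_ne0; rewrite Cmod_Rpos; lra.
have -> : c + (z - w) ^ n * u z - c * (1 + q * (s ^ n * U / A)%R) =
  (z - w) ^ n * (u z - u w).
  rewrite ez Cpow_mult_l hen -RtoC_pow RtoC_div; last by lra.
  by rewrite RtoC_mult; field.
rewrite Cmod_mult Cmod_pow ez hse.
have := h' z ltac:(rewrite ez hse; lra).
nra.
Qed.

(** Take q = 1: the main term has modulus |c| + x, the error at most x/2. *)
Lemma perturbation_increase u w (c : C) n (d : R) :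
  cont_at u w -> u w <> 0 -> c <> 0 -> (0 < n)%nat -> (0 < d)%R ->
  exists z, z <> w /\ (Cmod (z - w) < d)%R /\
    (Cmod c < Cmod (c + (z - w) ^ n * u z))%R.
Proof.
move=> hu hu0 hc hn hd.
have pc := Cmod_pos _ hc.
have [z [x [h1 [h2 [h3 h4]]]]] := perturbation_direction u w c 1 n d hu hu0 hc Cmod_1 hn hd.
exists z; do 2!split=> //.
have h5 := Cmod_triangle_rev (c * (1 + 1 * (x / Cmod c)%R)) (c + (z - w) ^ n * u z).
rewrite Cmod_minus_sym Cmod_mult in h5.
have e : Cmod (1 + 1 * (x / Cmod c)%R) = (1 + x / Cmod c)%R.
  rewrite Cmult_1_l -RtoC_plus Cmod_Rpos //.
  have : (0 < x / Cmod c)%R by apply: Rdiv_lt_0_compat; lra.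
  lra.
rewrite e in h5.
have e2 : (Cmod c * (1 + x / Cmod c) = Cmod c + x)%R by field; lra.
rewrite e2 in h5; lra.
Qed.

(** Take q = -1: as x is at most |c|, the main term has modulus exactly |c| - x, and the error is at
    most x/2. *)
Lemma perturbation_decrease u w (c : C) n (d : R) :
  cont_at u w -> u w <> 0 -> c <> 0 -> (0 < n)%nat -> (0 < d)%R ->
  exists z, z <> w /\ (Cmod (z - w) < d)%R /\
    (Cmod (c + (z - w) ^ n * u z) < Cmod c)%R.
Proof.
move=> hu hu0 hc hn hd.
have pc := Cmod_pos _ hc.
have [z [x [h1 [h2 [h3 h4]]]]] := perturbation_direction u w c (-(1)) n d hu hu0 hc
  Cmod_m1 hn hd.
exists z; do 2!split=> //.
have h5 := Cmod_triangle_rev (c + (z - w) ^ n * u z) (c * (1 + -(1) * (x / Cmod c)%R)).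
rewrite Cmod_mult in h5.
have e : Cmod (1 + -(1) * (x / Cmod c)%R) = (1 - x / Cmod c)%R.
  have -> : 1 + -(1) * (x / Cmod c)%R = RtoC (1 - x / Cmod c) by rewrite RtoC_minus; ring.
  rewrite Cmod_Rpos //.
  have : (x / Cmod c <= 1)%R; last by lra.
  apply: (Rmult_le_reg_r (Cmod c)) => //.
  have -> : (x / Cmod c * Cmod c = x)%R by field; lra.
  lra.
rewrite e in h5.
have e2 : (Cmod c * (1 - x / Cmod c) = Cmod c - x)%R by field; lra.
rewrite e2 in h5; lra.
Qed.

Lemma max_modulus f w : analytic f -> f w <> 0 ->
  near w (fun z => (Cmod (f z) <= Cmod (f w))%R) -> forall z, f z = f w.
Proof.
move=> hf h0 [d [hd hmax]] z; apply: NNPP => hz.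
have [n hn] := analytic_has_order_of_neq f (f w) w z hf hz.
have hpos := has_order_gt0 _ _ _ hn (Csub_diag _).
have [u [hu [hu0 e]]] := hn.
have [z' [_ [h1 h2]]] := perturbation_increase u w (f w) n d hu hu0 h0 hpos hd.
have := hmax z' h1; rewrite -e in h2.
have e' : f w + (f z' - f w) = f z' by ring.
rewrite e' in h2; lra.
Qed.

(** Without a maximum, every point of the square has a ball in which F on K stays below the value at
    some point of K. Finitely many balls cover, and the best of their finitely many witnesses m
    would satisfy F m < F m. Only upper semicontinuity is asked of F, and minima are obtained by
    applying this to [- Cmod]. *)
Lemma compact_max (K : unit_disc -> Prop) (F : unit_disc -> R) (rho : R) :
  (rho < 1)%R -> (forall z, K z -> (Cmod z <= rho)%R) ->
  (forall w, ~ K w -> near w (fun z => ~ K z)) ->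
  (forall w (eps : R), (0 < eps)%R -> near w (fun z => (F z < F w + eps)%R)) ->
  (exists z, K z) -> exists w, K w /\ forall z, K z -> (F z <= F w)%R.
Proof.
move=> hrho hK hclosed hF [k0 hk0]; apply: NNPP => hno.
have hbig w : K w -> exists w', K w' /\ (F w < F w')%R.
  move=> hw; apply: NNPP => h; apply: hno; exists w; split=> // z hz.
  by apply: Rnot_lt_le => hlt; apply: h; exists z.
pose Q (p : C) (d : R) w' := K w' /\ forall z, K z -> (Cmod (z - p) < d)%R -> (F z < F w')%R.
have hQ (p : Compactness.Tn 2 R) : exists d : posreal, exists w', Q (p.1, p.2.1) d w'.
  set c : C := (p.1, p.2.1).
  case: (Rlt_le_dec rho (Cmod c)) => hc.
    have hd : (0 < Cmod c - rho)%R by lra.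
    exists (mkposreal _ hd), k0; split=> // z hz /= hlt.
    have := hK z hz; have := Cmod_triangle_rev c z.
    rewrite Cmod_minus_sym; lra.
  have [w hw] := disc_of c ltac:(lra).
  case: (classic (K w)) => hKw.
    have [w' [hw' hlt]] := hbig w hKw.
    have [d [hd h]] := hF w (F w' - F w)%R ltac:(lra).
    exists (mkposreal d hd), w'; split=> // z hz /=; rewrite -hw => hzw.
    have := h z hzw; lra.
  have [d [hd h]] := hclosed w hKw.
  exists (mkposreal d hd), k0; split=> // z hz /=; rewrite -hw => hzw.
  by case: (h z hzw).
pose delta p := proj1_sig (constructive_indefinite_description _ (hQ p)).
have hdelta p : exists w', Q (p.1, p.2.1) (delta p) w'.
  by rewrite /delta; case: constructive_indefinite_description.
(* The covering uses boxes; a box of half-width [delta / 2] lies in the ball of radius [delta]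
   because sqrt 2 < 2. *)
pose delta2 p := mkposreal _ (is_pos_div_2 (delta p)).
apply: (compactness_list 2 (-1, (-1, tt))%R (1, (1, tt))%R delta2) => [[l hl]].
have [m [hm hmax]] : exists m, K m /\
    forall p, In p l -> forall z, K z -> (Cmod (z - (p.1, p.2.1)) < delta p)%R -> (F z < F m)%R.
  elim: l {hl} => [|p l [m [hm IH]]]; first by exists k0.
  have [w' [hw' h]] := hdelta p.
  case: (Rle_lt_dec (F m) (F w')) => hle.
    exists w'; split=> // p' [<-|hp'] z hz hzp; first exact: h.
    by apply: Rlt_le_trans (IH p' hp' z hz hzp) hle.
  exists m; split=> // p' [<-|hp'] z hz hzp; last exact: IH hzp.
  by apply: Rlt_trans (h z hz hzp) hle.
have hmod := Rmax_Cmod (disc_val m); have hm1 := disc_lt1 m.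
have hl1 := Rmax_l (Rabs (fst (disc_val m))) (Rabs (snd (disc_val m))).
have hr1 := Rmax_r (Rabs (fst (disc_val m))) (Rabs (snd (disc_val m))).
have b1 := Rabs_le_between (fst (disc_val m)) 1; have b2 := Rabs_le_between (snd (disc_val m)) 1.
have [[p1 [p2 []]] [hp [_ [c1 [c2 _]]]]] := hl (fst (disc_val m), (snd (disc_val m), tt))
  ltac:(split; [apply b1; lra | split; [apply b2; lra | by []]]).
have := hmax _ hp m hm.
suff h : (Cmod (m - (p1, p2)) < delta (p1, (p2, tt)))%R by move=> /(_ h); lra.
apply: Rle_lt_trans (Cmod_2Rmax _) _.
have hsq : (sqrt 2 < 2)%R.
  have := sqrt_less_alt 2 ltac:(lra); lra.
have hsq0 : (0 < sqrt 2)%R by apply: sqrt_lt_R0; lra.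
have hlt : (Rmax (Rabs (fst (m - (p1, p2))%C)) (Rabs (snd (m - (p1, p2))%C)) <
   delta (p1, (p2, tt)) / 2)%R.
  by apply: Rmax_lub_lt.
set X := Rmax _ _ in hlt *; set Y := pos _ in hlt *.
have hX : (0 <= X)%R by apply: Rle_trans (Rabs_pos _) (Rmax_l _ _).
nra.
Qed.

(** * Openness of injective maps and behaviour at the boundary *)

Lemma Cmod_cont_lt f w (eps : R) : cont_at f w -> (0 < eps)%R ->
  near w (fun z => (Cmod (f z) < Cmod (f w) + eps)%R).
Proof.
move=> hf he; apply: near_imp (hf eps he) => z hz.
have := Cmod_triangle_rev (f z) (f w); lra.
Qed.

Lemma Cmod_cont_gt f w (eps : R) : cont_at f w -> (0 < eps)%R ->
  near w (fun z => (- Cmod (f z) < - Cmod (f w) + eps)%R).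
Proof.
move=> hf he; apply: near_imp (hf eps he) => z hz.
rewrite Cmod_minus_sym in hz; have := Cmod_triangle_rev (f w) (f z); lra.
Qed.

(** Injectivity makes the minimum m of |f - f(w)| on a small circle positive. For |y - f(w)| < m/2,
    the minimum of |f - y| on the closed ball is not attained on the circle, where it would exceed
    the value at the centre; at an interior point a nonzero minimum could be decreased. *)
Lemma injective_open f w (r : R) : analytic f -> injective f -> (0 < r)%R ->
  exists d : R, (0 < d)%R /\ forall y : C, (Cmod (y - f w) < d)%R ->
    exists z, (Cmod (z - w) < r)%R /\ f z = y.
Proof.
move=> hf hinj hr; have hw := disc_lt1 w.
set s := (Rmin r (1 - Cmod w) / 2)%R.
have h1 := Rmin_l r (1 - Cmod w); have h2 := Rmin_r r (1 - Cmod w).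
have h3 : (0 < Rmin r (1 - Cmod w))%R by apply: Rmin_glb_lt; lra.
have hs : (0 < s)%R by rewrite /s; lra.
have hsr : (s < r)%R by rewrite /s; lra.
have hsw : (Cmod w + s < 1)%R by rewrite /s; lra.
have hms : Cmod s = s by apply: Cmod_Rpos; lra.
have hball z : (Cmod (z - w) <= s)%R -> (Cmod z <= Cmod w + s)%R.
  by move=> h; have := Cmod_triangle_rev z w; lra.
have hdist z z' : (Rabs (Cmod (z' - w) - Cmod (z - w)) <= Cmod (z' - z))%R.
  apply: Rabs_le.
  have := Cmod_triangle (z' - z) (z - w); have := Cmod_triangle (z - z') (z' - w).
  rewrite (Cmod_minus_sym z z').
  have -> : z' - z + (z - w) = z' - w by ring.
  have -> : z - z' + (z' - w) = z - w by ring.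
  lra.
have hcont (y : C) z : cont_at (fun z => f z - y) z.
  by apply: analytic_cont; apply: analytic_minus => //; apply: analytic_const.
have [z1 [hz1 hmin1]] : exists z1, Cmod (z1 - w) = s /\
    forall z, Cmod (z - w) = s -> (- Cmod (f z - f w) <= - Cmod (f z1 - f w))%R.
  apply: (compact_max (fun z => Cmod (z - w) = s) _ (Cmod w + s)) => //.
  - by move=> z hz; apply: hball; lra.
  - move=> z hz; exists (Rabs (Cmod (z - w) - s)).
    split; first by apply: Rabs_pos_lt; lra.
    move=> z' hz' e; have := hdist z z'; rewrite e Rabs_minus_sym; lra.
  - by move=> z eps he; apply: Cmod_cont_gt.
  - have [z hz] := disc_shift w s ltac:(lra).
    exists z; rewrite hz; have -> : w + s - w = s by ring.
    exact: hms.
set m := Cmod (f z1 - f w) in hmin1.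
have hm : (0 < m)%R.
  apply: Cmod_pos => e; have e' : f z1 = f w by rewrite -(Cplus_0_r (f w)) -e; ring.
  move: hz1; rewrite (hinj _ _ e'); have -> : w - w = 0 by ring.
  rewrite Cmod_0; lra.
exists (m / 2)%R; split; first by lra.
move=> y hy.
have [z0 [hz0 hmin0]] : exists z0, (Cmod (z0 - w) <= s)%R /\
    forall z, (Cmod (z - w) <= s)%R -> (- Cmod (f z - y) <= - Cmod (f z0 - y))%R.
  apply: (compact_max (fun z => (Cmod (z - w) <= s)%R) _ (Cmod w + s)) => //.
  - move=> z hz; exists (Cmod (z - w) - s)%R; split; first by lra.
    move=> z' hz'; have := hdist z z'; have := Rle_abs (- (Cmod (z' - w) - Cmod (z - w))).
    rewrite Rabs_Ropp; lra.
  - by move=> z eps he; apply: Cmod_cont_gt.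
  - exists w; have -> : w - w = 0 by ring.
    rewrite Cmod_0; lra.
exists z0; split; first by lra.
apply: NNPP => hne.
have hc0 : f z0 - y <> 0.
  by move=> e; apply: hne; rewrite -(Cplus_0_r y) -e; ring.
have hlt : (Cmod (z0 - w) < s)%R.
  case: hz0 => // e; have := hmin1 z0 e.
  have := hmin0 w; have -> : w - w = 0 by ring.
  rewrite Cmod_0 => /(_ ltac:(lra)).
  have := Cmod_triangle (f z0 - y) (y - f w).
  have -> : f z0 - y + (y - f w) = f z0 - f w by ring.
  rewrite (Cmod_minus_sym (f w)); lra.
have [z2 [hz2 _]] := near_pick z0 (fun _ => True) ltac:(by exists 1%R; split; [lra|]).
have [n hn] := analytic_has_order_of_neq f (f z0) z0 z2 hf (fun e => hz2 (hinj _ _ e)).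
have hpos := has_order_gt0 _ _ _ hn (Csub_diag _).
have [u [hu [hu0 e]]] := hn.
have [z [_ [k1 k2]]] := perturbation_decrease u z0 (f z0 - y) n (s - Cmod (z0 - w))%R
  hu hu0 hc0 hpos ltac:(lra).
rewrite -e in k2.
have e2 : f z0 - y + (f z - f z0) = f z - y by ring.
rewrite e2 in k2.
have := hmin0 z; have := Cmod_triangle (z - z0) (z0 - w).
have -> : z - z0 + (z0 - w) = z - w by ring.
move=> k3 /(_ ltac:(lra)); lra.
Qed.

Lemma inverse_cont (phi psi : unit_disc -> unit_disc) :
  analytic_self_map phi -> cancel phi psi -> cancel psi phi ->
  forall y, disc_cont_at psi y.
Proof.
move=> hphi h1 h2 y eps he.
have hinj : injective (fun z => phi z : C).
  by move=> z z' e; apply: (can_inj h1); apply: disc_eq.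
have [d [hd h]] := injective_open _ (psi y) eps hphi hinj he.
exists d; split=> // y' hy'.
rewrite h2 in h; have [z [hz e]] := h y' hy'.
by have -> : psi y' = z by rewrite -(h1 z); congr psi; apply: disc_eq.
Qed.

(** [rho] is the largest modulus of [psi] on the compact ball of radius 1 - eps; if [phi z] lies in
    that ball, then z = psi(phi z) has modulus at most [rho]. *)
Lemma proper_of_inverse_cont (phi psi : unit_disc -> unit_disc) :
  cancel phi psi -> (forall y, disc_cont_at psi y) ->
  forall eps : R, (0 < eps)%R -> exists rho : R, (rho < 1)%R /\
    forall z, (rho < Cmod z)%R -> (1 - eps < Cmod (phi z))%R.
Proof.
move=> h1 hpsi eps he.
case: (classic (exists y : unit_disc, (Cmod y <= 1 - eps)%R)) => hne; last first.
  exists 0%R; split; first by lra.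
  by move=> z _; apply: Rnot_le_lt => hle; apply: hne; exists (phi z).
have [w [hw hmax]] : exists w, (Cmod w <= 1 - eps)%R /\
    forall z, (Cmod z <= 1 - eps)%R -> (Cmod (psi z) <= Cmod (psi w))%R.
  apply: (compact_max (fun z => (Cmod z <= 1 - eps)%R) (fun z => Cmod (psi z)) (1 - eps)) => //.
  - by lra.
  - move=> z hz; exists (Cmod z - (1 - eps))%R; split; first by lra.
    move=> z' hz' hle; rewrite Cmod_minus_sym in hz'.
    have := Cmod_triangle_rev z z'; lra.
  - by move=> z e' he'; apply: (Cmod_cont_lt (fun z => psi z : C)) => //; apply: hpsi.
exists (Cmod (psi w)); split; first exact: disc_lt1.
move=> z hz; apply: Rnot_le_lt => hle.
have := hmax _ hle; rewrite h1; lra.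
Qed.

(** If |f(z1)| > 1, then |f| is below |f(z1)| near the boundary, so its maximum over a large enough
    closed ball is global; f is then constant, which contradicts the bound near the boundary. *)
Lemma boundary_le1 f : analytic f ->
  (forall eps : R, (0 < eps)%R -> exists rho : R, (rho < 1)%R /\
    forall z, (rho < Cmod z)%R -> (Cmod (f z) < 1 + eps)%R) ->
  forall z, (Cmod (f z) <= 1)%R.
Proof.
move=> hf hb z1; apply: Rnot_lt_le => hgt.
have [rho [hrho h]] := hb (Cmod (f z1) - 1)%R ltac:(lra).
have [w [hw hmax]] : exists w, (Cmod w <= Rmax rho (Cmod z1))%R /\
    forall z, (Cmod z <= Rmax rho (Cmod z1))%R -> (Cmod (f z) <= Cmod (f w))%R.
  apply: (compact_max (fun z => (Cmod z <= Rmax rho (Cmod z1))%R)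
    (fun z => Cmod (f z)) (Rmax rho (Cmod z1))) => //.
  - by apply: Rmax_lub_lt => //; apply: disc_lt1.
  - move=> z hz; exists (Cmod z - Rmax rho (Cmod z1))%R; split; first by lra.
    move=> z' hz' hle; rewrite Cmod_minus_sym in hz'.
    have := Cmod_triangle_rev z z'; lra.
  - by move=> z e' he'; apply: Cmod_cont_lt => //; apply: analytic_cont.
  - by exists z1; apply: Rmax_r.
have hz1 := hmax z1 (Rmax_r _ _).
have hglob z : (Cmod (f z) <= Cmod (f w))%R.
  case: (Rle_lt_dec (Cmod z) (Rmax rho (Cmod z1))) => hz; first exact: hmax.
  have := h z (Rle_lt_trans _ _ _ (Rmax_l _ _) hz); lra.
have hw0 : f w <> 0 by apply: Cmod_ne0; lra.
have hcst := max_modulus f w hf hw0 ltac:(by exists 1%R; split; [lra|]).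
have [z hz] : exists z, (rho < Cmod z)%R.
  set x := ((1 + Rmax rho 0) / 2)%R.
  have k1 := Rmax_l rho 0; have k2 := Rmax_r rho 0.
  have k3 : (Rmax rho 0 < 1)%R by apply: Rmax_lub_lt; lra.
  have hx : Cmod x = x by apply: Cmod_Rpos; rewrite /x; lra.
  have [z hz] := disc_of x ltac:(rewrite hx /x; lra).
  by exists z; rewrite hz hx /x; lra.
have := h z hz; rewrite hcst; lra.
Qed.

Lemma boundary_unimodular f : analytic f -> (forall z, f z <> 0) ->
  (forall eps : R, (0 < eps)%R -> exists rho : R, (rho < 1)%R /\
    forall z, (rho < Cmod z)%R -> (1 - eps < Cmod (f z) < 1 + eps)%R) ->
  exists c, Cmod c = 1%R /\ forall z, f z = c.
Proof.
move=> hf h0 hb.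
have hle : forall z, (Cmod (f z) <= 1)%R.
  apply: boundary_le1 => // eps he; have [rho [hrho h]] := hb eps he.
  by exists rho; split=> // z hz; have := h z hz; lra.
have hge : forall z, (Cmod (/ f z) <= 1)%R.
  apply: boundary_le1; first exact: analytic_inv.
  move=> eps he.
  (* The reciprocal of [1 - eps / (1 + eps)] is exactly [1 + eps]. *)
  have he' : (0 < eps / (1 + eps))%R by apply: Rdiv_lt_0_compat; lra.
  have [rho [hrho h]] := hb _ he'; exists rho; split=> // z hz.
  have [k _] := h z hz; have hp := Cmod_pos _ (h0 z).
  rewrite Cmod_inv //; apply: (Rmult_lt_reg_r (Cmod (f z))) => //.
  rewrite Rinv_l; last by lra.
  have e : ((1 + eps) * (1 - eps / (1 + eps)) = 1)%R by field; lra.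
  by have := Rmult_lt_compat_l (1 + eps) _ _ ltac:(lra) k; rewrite e.
have h1 z : Cmod (f z) = 1%R.
  apply: Rle_antisym => //; have := hge z; have hp := Cmod_pos _ (h0 z).
  rewrite Cmod_inv // => hi.
  have := Rmult_le_compat_r _ _ _ (Rlt_le _ _ hp) hi.
  rewrite Rinv_l; lra.
have [o _] := disc_of 0 ltac:(rewrite Cmod_0; lra).
exists (f o); split=> //; apply: max_modulus => //.
by exists 1%R; split; [lra | move=> z _; rewrite !h1; lra].
Qed.

(** * The algebra [BHinf B] and the preimages of [B] and [z B] *)

Lemma Csub_eq0 (x y : C) : x - y = 0 -> x = y.
Proof. by move=> e; rewrite -(Cplus_0_r y) -e; ring. Qed.

Lemma Cmult_reg_l (x y y' : C) : x <> 0 -> x * y = x * y' -> y = y'.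
Proof.
move=> hx e; have -> : y = / x * (x * y) by field.
by rewrite e; field.
Qed.

Lemma Cinv_neq_0 (x : C) : x <> 0 -> / x <> 0.
Proof.
move=> h; apply: Cmod_ne0; rewrite Cmod_inv //.
exact/Rinv_0_lt_compat/Cmod_pos.
Qed.

Lemma Hinf_const (c : C) : Hinf (fun _ => c).
Proof. by split; [exact: analytic_const | exists (Cmod c) => z; lra]. Qed.

Lemma Hinf_id : Hinf (fun z => z : C).
Proof.
by split; [exact: analytic_id | exists 1%R => z; have := disc_lt1 z; lra].
Qed.

Lemma Hinf_plus f g : Hinf f -> Hinf g -> Hinf (fun z => f z + g z).
Proof.
move=> [hf [M hM]] [hg [N hN]]; split; first exact: analytic_plus.
exists (M + N)%R => z; apply: Rle_trans (Cmod_triangle _ _) _.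
by apply: Rplus_le_compat.
Qed.

Lemma Hinf_mult f g : Hinf f -> Hinf g -> Hinf (fun z => f z * g z).
Proof.
move=> [hf [M hM]] [hg [N hN]]; split; first exact: analytic_mult.
exists (M * N)%R => z; rewrite Cmod_mult.
by apply: Rmult_le_compat => //; apply: Cmod_ge_0.
Qed.

Lemma Hinf_scal (c : C) f : Hinf f -> Hinf (fun z => c * f z).
Proof. exact: Hinf_mult (Hinf_const c). Qed.

Lemma Hinf_ext f g : (forall z, f z = g z) -> Hinf f -> Hinf g.
Proof. by move=> /functional_extensionality ->. Qed.

Lemma Hinf_minus f g : Hinf f -> Hinf g -> Hinf (fun z => f z - g z).
Proof.
move=> hf hg; apply: (Hinf_ext (fun z => f z + -(1) * g z)) => [z|]; first by ring.
exact: Hinf_plus hf (Hinf_scal _ _ hg).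
Qed.

Lemma Hinf_self_map phi : analytic_self_map phi -> Hinf (fun z => phi z : C).
Proof.
by move=> h; split=> //; exists 1%R => z; have := disc_lt1 (phi z); lra.
Qed.

Lemma Hinf_comp f phi : Hinf f -> analytic_self_map phi -> Hinf (fun z => f (phi z)).
Proof.
move=> [hf [M hM]] hphi; split; first exact: analytic_comp.
by exists M.
Qed.

(** The quotient is bounded near w by continuity, and at distance at least d from w by M/d. *)
Lemma Hinf_divide f w : Hinf f -> f w = 0 ->
  exists k, Hinf k /\ forall z, f z = (z - w) * k z.
Proof.
move=> [hf [M hM]] h0; have [a ha] := hf w.
have ha0 : a 0%nat = 0.
  have [r [hr h]] := proj1 (power_series_atP _ _ _) ha.
  rewrite -h0 -(germ_at0 f w); apply: is_cseries_uniq (is_ps_0 a) _; apply: h.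
  by rewrite Cmod_0.
have [k [hk [_ e]]] := analytic_factor f w a 1 hf ha
  (fun j hj => ltac:(by have -> : j = 0%nat by lia)).
exists k; split; last by move=> z; rewrite e Cpow_1_r.
split=> //.
have [d [hd hnear]] := analytic_cont k w hk 1%R Rlt_0_1.
have hM0 : (0 <= M)%R by apply: Rle_trans (hM w); apply: Cmod_ge_0.
have hMd : (0 <= M / d)%R by apply: Rmult_le_pos => //; apply/Rlt_le/Rinv_0_lt_compat.
exists (Cmod (k w) + 1 + M / d)%R => z.
have hk0 := Cmod_ge_0 (k w).
case: (Rlt_le_dec (Cmod (z - w)) d) => hz.
  have := hnear z hz; have := Cmod_triangle_rev (k z) (k w); lra.
have h1 := hM z; rewrite e Cpow_1_r Cmod_mult in h1.
suff : (Cmod (k z) <= M / d)%R by lra.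
apply: (Rmult_le_reg_l d) => //.
have -> : (d * (M / d) = M)%R by field; lra.
apply: Rle_trans h1; apply: Rmult_le_compat_r => //; exact: Cmod_ge_0.
Qed.

Lemma Hinf_inv_sub (c : C) : (1 < Cmod c)%R -> Hinf (fun z => / (z - c)).
Proof.
move=> hc.
have hlow z : (Cmod c - 1 < Cmod (z - c))%R.
  by rewrite Cmod_minus_sym; have := Cmod_triangle_rev c z; have := disc_lt1 z; lra.
have hne z : z - c <> 0 by apply: Cmod_ne0; have := hlow z; lra.
split.
  by apply: analytic_inv hne _; apply: analytic_minus; [exact: analytic_id | exact: analytic_const].
exists (/ (Cmod c - 1))%R => z; rewrite Cmod_inv //.
by apply: Rinv_le_contravar; [lra | have := hlow z; lra].
Qed.

Lemma BHinf_intro B f : Hinf f -> BHinf B (fun z => B z * f z).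
Proof. by move=> hf; exists f. Qed.

Lemma BHinf_Hinf B F : Hinf B -> BHinf B F -> Hinf F.
Proof. by move=> hB [f [hf ->]]; apply: Hinf_mult. Qed.

Lemma BHinf_ext B f g : (forall z, f z = g z) -> BHinf B f -> BHinf B g.
Proof. by move=> /functional_extensionality ->. Qed.

Lemma BHinf_mult B F k : BHinf B F -> Hinf k -> BHinf B (fun z => F z * k z).
Proof.
move=> [f [hf ->]] hk; apply: (BHinf_ext _ (fun z => B z * (f z * k z))).
  by move=> z; ring.
exact: BHinf_intro (Hinf_mult _ _ hf hk).
Qed.

Lemma BHinf_minus B F G : BHinf B F -> BHinf B G -> BHinf B (fun z => F z - G z).
Proof.
move=> [f [hf ->]] [g [hg ->]].
apply: (BHinf_ext _ (fun z => B z * (f z - g z))); first by move=> z; ring.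
exact: BHinf_intro (Hinf_minus _ _ hf hg).
Qed.

Lemma BHinf_scal B (c : C) F : BHinf B F -> BHinf B (fun z => c * F z).
Proof.
move=> hF; apply: (BHinf_ext _ (fun z => F z * c)); first by move=> z; ring.
exact: BHinf_mult hF (Hinf_const c).
Qed.

Lemma automorphism_preimage B phi f :
  algebra_automorphism (BHinf B) (comp_op phi) -> Hinf f ->
  exists F, BHinf B F /\ forall z, F (phi z) = B z * f z.
Proof.
move=> [_ [_ [_ [_ [_ hsurj]]]]] hf.
have [F [hF e]] := hsurj _ (BHinf_intro B f hf).
by exists F; split=> // z; rewrite -[LHS]/(comp_op phi F z) e.
Qed.

(** Injectivity of the operator stands in for the still unknown surjectivity of [phi]. *)
Lemma automorphism_inj B phi F G :
  algebra_automorphism (BHinf B) (comp_op phi) -> BHinf B F -> BHinf B G ->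
  (forall z, F (phi z) = G (phi z)) -> forall z, F z = G z.
Proof.
move=> [_ [_ [_ [_ [hinj _]]]]] hF hG h z.
by rewrite (hinj F G hF hG) //; apply: functional_extensionality.
Qed.

(* The quotient [H / G] is the inverse of [phi]: if it took a value [c] outside
   the closed disc, [B / (z - c)] would have no preimage. *)
Lemma preimage_quotient_le B phi G H :
  algebra_automorphism (BHinf B) (comp_op phi) -> Hinf B ->
  BHinf B G -> (forall z, G (phi z) = B z) ->
  BHinf B H -> (forall z, H (phi z) = B z * z) ->
  forall w, G w <> 0 -> (Cmod (H w) <= Cmod (G w))%R.
Proof.
move=> haut hB hG eG hH eH w hw; apply: Rnot_lt_le => hlt.
have hGp := Cmod_pos _ hw.
set c := H w / G w.
have hc : (1 < Cmod c)%R.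
  rewrite /c Cmod_div //; apply: (Rmult_lt_reg_r (Cmod (G w))) => //.
  have -> : (Cmod (H w) / Cmod (G w) * Cmod (G w) = Cmod (H w))%R by field; lra.
  lra.
have [L [hL eL]] := automorphism_preimage B phi _ haut (Hinf_inv_sub c hc).
have e := automorphism_inj B phi (fun z => (H z - c * G z) * L z) (fun z => G z * G z)
  haut _ _ _ w.
have : (H w - c * G w) * L w = G w * G w.
  apply: e.
  - apply: BHinf_mult; last exact: BHinf_Hinf hL.
    exact: BHinf_minus hH (BHinf_scal _ _ _ hG).
  - by apply: BHinf_mult => //; apply: BHinf_Hinf hG.
  - move=> z; rewrite eL eG eH; field.
    apply: Cmod_ne0; rewrite Cmod_minus_sym.
    have := Cmod_triangle_rev c z; have := disc_lt1 z; lra.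
have -> : H w - c * G w = 0 by rewrite /c; field.
rewrite Cmult_0_l => e0.
by case: (Cmult_neq_0 _ _ hw hw).
Qed.

Lemma preimage_quotient_inverse B phi G H (b w : unit_disc) :
  algebra_automorphism (BHinf B) (comp_op phi) -> Hinf B -> analytic_self_map phi ->
  BHinf B G -> (forall z, G (phi z) = B z) ->
  BHinf B H -> (forall z, H (phi z) = B z * z) ->
  G w <> 0 -> H w = b * G w -> phi b = w.
Proof.
move=> haut hB hphi hG eG hH eH hw hb.
have hd : Hinf (fun z => phi z - phi b).
  exact: Hinf_minus (Hinf_self_map _ hphi) (Hinf_const _).
(* [K] will be the preimage of [B k]. Under [phi], both sides of [e] below become
   [(phi z - phi b) B^2 = (z - b) k B^2]. *)
have [k [hk ek]] := Hinf_divide _ b hd (Csub_diag _).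
have [K [hK eK]] := automorphism_preimage B phi _ haut hk.
have GH : Hinf G by apply: BHinf_Hinf hG.
have e : (w - phi b) * G w * G w = (H w - b * G w) * K w.
  apply: (automorphism_inj B phi (fun z => (z - phi b) * G z * G z)
    (fun z => (H z - b * G z) * K z) haut).
  - apply: BHinf_mult => //; apply: (BHinf_ext _ (fun z => G z * (z - phi b))).
      by move=> z; ring.
    by apply: BHinf_mult => //; exact: Hinf_minus Hinf_id (Hinf_const _).
  - apply: BHinf_mult; last exact: BHinf_Hinf hK.
    exact: BHinf_minus hH (BHinf_scal _ _ _ hG).
  - by move=> z; rewrite eG eH eK ek; ring.
rewrite hb Csub_diag Cmult_0_l in e.
apply: disc_eq; apply/esym/Csub_eq0; apply: NNPP => hne.
by case: (Cmult_neq_0 _ _ (Cmult_neq_0 _ _ hne hw) hw).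
Qed.

Lemma automorphism_surjective B phi :
  algebra_automorphism (BHinf B) (comp_op phi) -> Hinf B -> analytic_self_map phi ->
  (forall c : C, exists z, B z <> 0 /\ (z : C) <> c) ->
  forall w, exists b, phi b = w.
Proof.
move=> haut hB hphi hB0 w.
have [G [hG eG']] := automorphism_preimage B phi _ haut (Hinf_const 1).
have eG z : G (phi z) = B z by rewrite eG'; ring.
have [H [hH eH]] := automorphism_preimage B phi _ haut Hinf_id.
have hle := preimage_quotient_le B phi G H haut hB hG eG hH eH.
have [Ga _] := BHinf_Hinf _ _ hB hG; have [Ha _] := BHinf_Hinf _ _ hB hH.
(* By the identity theorem it would vanish everywhere, but at [phi z] it is [B z * (z - c)]. *)
have noloc (c : C) : ~ near w (fun z => H z - c * G z = 0).
  move=> h; have [z [hz hzc]] := hB0 c.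
  have hana : analytic (fun z => H z - c * G z).
    by apply: analytic_minus => //; apply: analytic_scal.
  have := identity_theorem _ _ hana h (phi z); rewrite eG eH.
  have -> : B z * z - c * B z = B z * (z - c) by ring.
  by apply: Cmult_neq_0 => // e; apply: hzc; apply: Csub_eq0.
case: (analytic_order G w Ga) => [h|[m [u [hu [hu0 eu]]]]].
  have [z [hz _]] := hB0 0.
  by case: hz; rewrite -eG; apply: identity_theorem h _.
case: (analytic_order H w Ha) => [h|[m' [v [hv [hv0 ev]]]]].
  by case: (noloc 0); apply: near_imp h => z ->; ring.
have cu := analytic_cont _ w hu; have cv := analytic_cont _ w hv.
have hGz : near w (fun z => z <> w -> G z <> 0).
  by apply: (has_order_near _ _ m); exists u.
(* |H| is at most |G| off w, so H vanishes at w to at least the order of G; otherwise dividing by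
   [(z - w) ^ m'] would give [v w = 0] in the limit. Hence [v' / u] below extends H/G continuously
   to w, with value [beta]. *)
have hmm : (m <= m')%nat.
  case: (le_lt_dec m m') => // hlt; case: hv0; apply: Cmod_eq_0.
  apply: Rle_antisym; last exact: Cmod_ge_0.
  have hc : cont_at (fun z => (z - w) ^ (m - m') * u z) w.
    by apply: cont_mult => //; apply: cont_pow; apply: cont_minus; [exact: cont_id | exact: cont_const].
  have -> : 0%R = Cmod ((w - w) ^ (m - m') * u w).
    have -> : (m - m' = S (m - m' - 1))%nat by lia.
    by rewrite Csub_diag Cpow_S !Cmult_0_l Cmod_0.
  apply: (lim_le v (fun z => (z - w) ^ (m - m') * u z)) => //.
  apply: near_imp hGz => z hz hzw; have := hle z (hz hzw).
  have hp := Cmod_pos _ (Cpow_nz _ m' (disc_sub_ne0 _ _ hzw)).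
  have -> : G z = (z - w) ^ m' * ((z - w) ^ (m - m') * u z).
    by rewrite eu Cmult_assoc -Cpow_add_r; congr (_ ^ _ * _); lia.
  rewrite ev Cmod_mult [X in (_ <= X)%R]Cmod_mult => h; exact: Rmult_le_reg_l h.
pose v' z := (z - w) ^ (m' - m) * v z.
have hv' : analytic v'.
  apply: analytic_mult => //; apply: analytic_pow; apply: analytic_minus.
    exact: analytic_id.
  exact: analytic_const.
have ev' z : H z = (z - w) ^ m * v' z.
  by rewrite /v' Cmult_assoc -Cpow_add_r ev; congr (_ ^ _ * _); lia.
have cv' := analytic_cont _ w hv'.
have hle' : near w (fun z => z <> w -> (Cmod (v' z) <= Cmod (u z))%R).
  apply: near_imp hGz => z hz hzw; have := hle z (hz hzw).
  have hp := Cmod_pos _ (Cpow_nz _ m (disc_sub_ne0 _ _ hzw)).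
  rewrite eu ev' Cmod_mult [X in (_ <= X)%R]Cmod_mult => h; exact: Rmult_le_reg_l h.
have hle0 : (Cmod (v' w) <= Cmod (u w))%R by apply: lim_le.
set beta := v' w / u w.
have hup := Cmod_pos _ hu0.
have hbu : beta * u w = v' w by rewrite /beta; field.
have hbuz : (Cmod beta * Cmod (u w) = Cmod (v' w))%R by rewrite -Cmod_mult hbu.
(* If |beta| is at least 1, writing [v' / u] as beta plus [(z - w) ^ n * (s / u)] produces a nearby
   point where its modulus exceeds 1. *)
have hb1 : (Cmod beta < 1)%R.
  apply: Rnot_le_lt => hge.
  have hbne : beta <> 0 by apply: Cmod_ne0; lra.
  have hana : analytic (fun z => v' z - beta * u z).
    by apply: analytic_minus => //; apply: analytic_scal.
  case: (analytic_has_order _ w hana) => [h|[n hn]].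
    case: (noloc beta); apply: near_imp h => z hz; rewrite ev' eu.
    have -> : (z - w) ^ m * v' z - beta * ((z - w) ^ m * u z) =
      (z - w) ^ m * (v' z - beta * u z) by ring.
    by rewrite hz; ring.
  have hval : v' w - beta * u w = 0 by rewrite hbu Csub_diag.
  have hpos := has_order_gt0 _ _ _ hn hval.
  have [s [hs [hs0 es]]] := hn.
  have [d [hd hdn]] := near_and _ _ _ hle' (cont_nonzero _ _ cu hu0).
  have [z [hzw [hzd hlt]]] := perturbation_increase (fun z => s z * / u z) w beta n d
    (cont_mult _ _ _ hs (cont_inv _ _ cu hu0))
    (Cmult_neq_0 _ _ hs0 (Cinv_neq_0 _ hu0)) hbne hpos hd.
  have [h1 h2] := hdn z hzd; have h3 := h1 hzw.
  have huz : u z <> 0 by apply: Cmod_ne0; lra.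
  have huzp := Cmod_pos _ huz.
  have ez : beta + (z - w) ^ n * (s z * / u z) = v' z / u z.
    have -> : v' z = beta * u z + (z - w) ^ n * s z by rewrite -es; ring.
    by field.
  rewrite ez Cmod_div // in hlt.
  have : (Cmod (v' z) / Cmod (u z) <= 1)%R; last by lra.
  apply: (Rmult_le_reg_r (Cmod (u z))) => //.
  have -> : (Cmod (v' z) / Cmod (u z) * Cmod (u z) = Cmod (v' z))%R by field; lra.
  lra.
have [b hb] := disc_of beta hb1.
exists b; apply: disc_eq; apply: NNPP => hne.
have hdist : (0 < Cmod (phi b - w) / 2)%R.
  suff : (0 < Cmod (phi b - w))%R by lra.
  by apply: Cmod_pos => e; apply: hne; apply: Csub_eq0.
(* Suppose [phi b] differs from w. A point z near w with [G z <> 0] has quotient b' close to b and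
   [phi b' = z], so continuity of [phi] at b puts [phi b] within half its distance to w from z, and
   z is within the other half from w. *)
have [d [hd hdn]] := analytic_cont _ b hphi _ hdist.
have cq : cont_at (fun z => v' z * / u z) w by apply: cont_mult => //; apply: cont_inv.
have hdmin : (0 < Rmin d (1 - Cmod beta))%R by apply: Rmin_glb_lt; lra.
have hself : near w (fun z => (Cmod (z - w) < Cmod (phi b - w) / 2)%R).
  by exists (Cmod (phi b - w) / 2)%R.
have [z [hzw [[[h1 h2] h3] h4]]] := near_pick _ _ (near_and _ _ _ (near_and _ _ _
  (near_and _ _ _ (cq _ hdmin) (cont_nonzero _ _ cu hu0)) hself) hGz).
have huz : u z <> 0 by apply: Cmod_ne0; lra.
have hl := Rmin_l d (1 - Cmod beta); have hr := Rmin_r d (1 - Cmod beta).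
have h1' : (Cmod (v' z * / u z - beta) < Rmin d (1 - Cmod beta))%R := h1.
have [b' hb'] := disc_of (v' z * / u z)
  ltac:(have := Cmod_triangle_rev (v' z * / u z) beta; lra).
have e' : phi b' = z.
  apply: (preimage_quotient_inverse B phi G H) => //; first exact: h4.
  by rewrite hb' ev' eu; field.
have := hdn b' ltac:(rewrite hb' hb; lra).
rewrite e' => h5; have := Cmod_triangle (phi b - z) (z - w).
have -> : phi b - z + (z - w) = phi b - w by ring.
rewrite Cmod_minus_sym in h5; lra.
Qed.

(** * Automorphisms of the disc and Blaschke products *)

Implicit Types (a : unit_disc) (phi psi : unit_disc -> unit_disc).

Lemma Copp_neq_0 (x : C) : x <> 0 -> - x <> 0.
Proof. by move=> /Cmod_pos h; apply: Cmod_ne0; rewrite Cmod_opp. Qed.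

Lemma has_order_ext f g w n : (forall z, f z = g z) -> has_order f w n -> has_order g w n.
Proof. by move=> /functional_extensionality ->. Qed.

Lemma has_order_sub w : has_order (fun z => z - w) w 1.
Proof.
exists (fun _ => 1); split; first exact: cont_const.
by split=> [|z]; [exact: C1_nz | ring].
Qed.

Lemma has_order_sub_ne w z : w <> z -> has_order (fun x : unit_disc => x - z) w 0.
Proof.
move=> h; apply: has_order_0; last exact: disc_sub_ne0.
by apply: cont_minus; [exact: cont_id | exact: cont_const].
Qed.

(** F cannot vanish near [phi w], since the composite would then vanish near w; so F has an order,
    and orders multiply. *)
Lemma has_order_of_comp F phi w k n : analytic F -> disc_cont_at phi w ->
  has_order (fun z => phi z - phi w) w k -> has_order (fun z => F (phi z)) w n ->
  exists m, has_order F (phi w) m /\ n = (k * m)%nat.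
Proof.
move=> hF hphi hk hn.
case: (analytic_has_order F (phi w) hF) => [h|[m hm]].
  by case: (has_order_nonzero _ _ _ hn); exact: near_comp hphi h.
exists m; split=> //.
exact: has_order_uniq hn (has_order_comp _ _ _ _ _ hphi hm hk).
Qed.

Lemma has_order_factor f g w n : analytic g -> has_order (fun z => f z * g z) w n ->
  forall m, has_order f w m -> (m <= n)%nat.
Proof.
move=> hg hn m hm.
case: (analytic_has_order g w hg) => [h|[j hj]].
  case: (has_order_nonzero _ _ _ hn); apply: near_imp h => z ->; ring.
by rewrite (has_order_uniq _ _ _ _ hn (has_order_mult _ _ _ _ _ hm hj)); lia.
Qed.

Lemma automorphism_injective_orders B phi :
  algebra_automorphism (BHinf B) (comp_op phi) -> Hinf B -> analytic_self_map phi ->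
  (forall w, exists n, has_order B w n) ->
  injective phi /\ forall w n, has_order B w n -> has_order B (phi w) n.
Proof.
move=> haut hB hphi hord.
have [G [hG eG']] := automorphism_preimage B phi _ haut (Hinf_const 1).
have eG z : G (phi z) = B z by rewrite eG'; ring.
have [H [hH eH]] := automorphism_preimage B phi _ haut Hinf_id.
have [Ga _] := BHinf_Hinf _ _ hB hG; have [Ha _] := BHinf_Hinf _ _ hB hH.
have cphi w : disc_cont_at phi w by apply: analytic_cont.
have aHG (c : C) : analytic (fun z => H z - c * G z).
  by apply: analytic_minus => //; apply: analytic_scal.
have eHG (c : C) z : B z * (z - c) = H (phi z) - c * G (phi z).
  by rewrite eG eH; ring.
(* Were [phi] constant near w, some z other than w with [B z <> 0] would have the same image; G then
   gives [B w = B z] and H gives [B w * w = B z * z], so z = w. *)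
have hk w : exists k, has_order (fun z => phi z - phi w) w k.
  have ha : analytic (fun z => phi z - phi w).
    by apply: analytic_minus => //; apply: analytic_const.
  case: (analytic_has_order _ w ha) => // hn.
  have [n hw] := hord w.
  have [z [hzw [h1 h2]]] := near_pick _ _ (near_and _ _ _ hn (has_order_near _ _ _ hw)).
  have e : phi z = phi w by apply: disc_eq; apply: Csub_eq0.
  have hBz := h2 hzw.
  case: hzw; apply: disc_eq; apply: (Cmult_reg_l (B z)) => //.
  have eBw : B w = B z by rewrite -(eG w) -(eG z) e.
  by rewrite -eH e eH eBw.
have hk1 w : has_order (fun z => phi z - phi w) w 1.
  have [k hkw] := hk w; have [n hn] := hord w.
  have [M [_ eM]] := has_order_of_comp G phi w k n Ga (cphi w) hkw
    (has_order_ext _ _ _ _ (fun z => esym (eG z)) hn).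
  have [N [_ eN]] := has_order_of_comp _ phi w k (n + 1) (aHG w) (cphi w) hkw
    (has_order_ext _ _ _ _ (eHG w) (has_order_mult _ _ _ _ _ hn (has_order_sub w))).
  have -> : 1%nat = k; last by [].
  (* From n = k M and n + 1 = k N. *)
  have e : (k * (N - M) = 1)%nat by rewrite Nat.mul_sub_distr_l; lia.
  by case: (Nat.eq_mul_1 k (N - M)) => /(_ e) [-> _].
have tr F w n : analytic F -> has_order (fun z => F (phi z)) w n -> has_order F (phi w) n.
  move=> hF hn; have [m [hm ->]] := has_order_of_comp F phi w 1 n hF (cphi w) (hk1 w) hn.
  by rewrite Nat.mul_1_l.
have ordG w n : has_order B w n -> has_order G (phi w) n.
  by move=> hn; apply: tr => //; apply: (has_order_ext B).
split.
  (* At the common image, G has both orders n and m, while H - z G has order n + 1 seen from z and m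
     seen from w. *)
  move=> z w e; apply: NNPP => hne.
  have [n hn] := hord z; have [m hm] := hord w.
  have h1 := tr _ z _ (aHG z) (has_order_ext _ _ _ _ (eHG z)
    (has_order_mult _ _ _ _ _ hn (has_order_sub z))).
  have h2 := tr _ w _ (aHG z) (has_order_ext _ _ _ _ (eHG z)
    (has_order_mult _ _ _ _ _ hm (has_order_sub_ne w z (fun e' => hne (esym e'))))).
  have h3 := ordG z n hn; have h4 := ordG w m hm.
  rewrite e in h1 h3.
  have := has_order_uniq _ _ _ _ h1 h2; have := has_order_uniq _ _ _ _ h3 h4; lia.
(* [B] divides G, which has order n at [phi w], so m is at most n; [B] divides B(phi z), which has
   order m at w, so n is at most m. *)
move=> w n hn; have [m hm] := hord (phi w).
have [Ba _] := hB.
have [g [[hg _] Eg]] := hG.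
have hGw := ordG w n hn; rewrite Eg in hGw.
have le1 := has_order_factor B g (phi w) n hg hGw m hm.
have [h [[hh _] Eh]] := proj1 haut _ (BHinf_intro B _ (Hinf_const 1)).
have hcomp := has_order_comp B phi w 1 m (cphi w) hm (hk1 w).
rewrite Nat.mul_1_l in hcomp.
have hBh : has_order (fun z => B z * h z) w m.
  apply: has_order_ext hcomp => z.
  have := f_equal (fun F => F z) Eh; rewrite /comp_op => <-; ring.
have le2 := has_order_factor B h w m hh hBh n hn.
by have -> : n = m by lia.
Qed.

(** * Blaschke factors and finite products *)

Lemma blaschke_den_ne0 a z : 1 - Cconj a * z <> 0.
Proof.
apply: Cmod_ne0; have := Cmod_triangle_rev 1 (Cconj a * z).
rewrite Cmod_1 Cmod_mult Cmod_conj.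
have ha := disc_lt1 a; have hz := disc_lt1 z.
have := Cmod_ge_0 a; have := Cmod_ge_0 z; nra.
Qed.

Lemma blaschke_lt1 a z : (Cmod (blaschke_factor a z) < 1)%R.
Proof.
have hd := Cmod_pos _ (blaschke_den_ne0 a z).
rewrite /blaschke_factor Cmod_div; last exact: blaschke_den_ne0.
apply: (Rmult_lt_reg_r (Cmod (1 - Cconj a * z))) => //.
rewrite /Rdiv Rmult_assoc Rinv_l; last by lra.
rewrite Rmult_1_r Rmult_1_l.
have e : (Cmod (1 - Cconj a * z) ^ 2 - Cmod (a - z) ^ 2 =
  (1 - Cmod a ^ 2) * (1 - Cmod z ^ 2))%R.
  rewrite !Cmod2_alt; case: (disc_val a) => a1 a2; case: (disc_val z) => z1 z2.
  rewrite /Re /Im /=; ring.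
have ha := disc_lt1 a; have hz := disc_lt1 z.
have ha0 := Cmod_ge_0 a; have hz0 := Cmod_ge_0 z.
have : (0 < (1 - Cmod a ^ 2) * (1 - Cmod z ^ 2))%R by apply: Rmult_lt_0_compat; nra.
have := Cmod_ge_0 (a - z); nra.
Qed.

Definition blaschke_map a z : unit_disc := exist _ (blaschke_factor a z) (blaschke_lt1 a z).

Lemma blaschke_map_involutive a : cancel (blaschke_map a) (blaschke_map a).
Proof.
move=> z; apply: disc_eq.
have hz := blaschke_den_ne0 a z; have ha := blaschke_den_ne0 a a.
have hb := blaschke_den_ne0 a (blaschke_map a z).
move: hb; rewrite /= /blaschke_factor /= => hb.
have e : 1 - Cconj a * ((a - z) / (1 - Cconj a * z)) = (1 - Cconj a * a) / (1 - Cconj a * z).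
  by field.
rewrite /= /blaschke_factor /= e; field; by split.
Qed.

Lemma analytic_blaschke_den a : analytic (fun z => 1 - Cconj a * z).
Proof.
apply: analytic_minus; first exact: analytic_const.
exact: analytic_scal analytic_id.
Qed.

Lemma analytic_blaschke a : analytic (blaschke_factor a).
Proof.
apply: analytic_mult.
  by apply: analytic_minus; [exact: analytic_const | exact: analytic_id].
by apply: analytic_inv (analytic_blaschke_den a); exact: blaschke_den_ne0.
Qed.

Definition disc_eq_dec (z w : unit_disc) : {z = w} + {z <> w} :=
  excluded_middle_informative (z = w).

Definition blaschke_prod (l : list unit_disc) (z : unit_disc) : C :=
  fold_right (fun a p => blaschke_factor a z * p) 1 l.

Lemma has_order_blaschke a w :
  has_order (blaschke_factor a) w (if disc_eq_dec a w is left _ then 1%nat else 0%nat).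
Proof.
case: disc_eq_dec => [->|hne].
  exists (fun z => - / (1 - Cconj w * z)); split.
    apply: analytic_cont; apply: (analytic_ext (fun z => -(1) * / (1 - Cconj w * z))).
      by move=> z; ring.
    by apply: analytic_scal; apply: analytic_inv (analytic_blaschke_den w); exact: blaschke_den_ne0.
  split; first exact/Copp_neq_0/Cinv_neq_0/blaschke_den_ne0.
  move=> z; rewrite /blaschke_factor; field; exact: blaschke_den_ne0.
apply: has_order_0; first exact/analytic_cont/analytic_blaschke.
apply: Cmult_neq_0; first exact: disc_sub_ne0.
exact/Cinv_neq_0/blaschke_den_ne0.
Qed.

Lemma analytic_blaschke_prod l : analytic (blaschke_prod l).
Proof.
elim: l => [|a l IH]; first exact: analytic_const.
exact: analytic_mult (analytic_blaschke a) IH.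
Qed.

Lemma has_order_blaschke_prod l w :
  has_order (blaschke_prod l) w (count_occ disc_eq_dec l w).
Proof.
elim: l => [|a l IH] /=.
  by apply: has_order_0; [exact: cont_const | exact: C1_nz].
have := has_order_mult _ _ _ _ _ (has_order_blaschke a w) IH.
by case: disc_eq_dec.
Qed.

Lemma blaschke_prod_le1 l z : (Cmod (blaschke_prod l z) <= 1)%R.
Proof.
elim: l => [|a l IH] /=; first by rewrite Cmod_1; lra.
rewrite Cmod_mult; have := blaschke_lt1 a z.
have := Cmod_ge_0 (blaschke_factor a z); have := Cmod_ge_0 (blaschke_prod l z).
rewrite -/(blaschke_prod l z); nra.
Qed.

Lemma blaschke_prod_permutation l l' z :
  Permutation l l' -> blaschke_prod l z = blaschke_prod l' z.
Proof. by elim=> //= [a ? ? _ ->|a b ?|? ? ? _ -> _ ->] //; ring. Qed.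

(** The first hypothesis embeds l in l' with multiplicities, and equal lengths leave no room for
    further entries. *)
Lemma count_occ_permutation l l' :
  (forall w, In w l -> count_occ disc_eq_dec l' w = count_occ disc_eq_dec l w) ->
  length l' = length l -> Permutation l l'.
Proof.
move=> h.
have {h} : forall w, (count_occ disc_eq_dec l w <= count_occ disc_eq_dec l' w)%nat.
  move=> w; case: (classic (In w l)) => hw; first by rewrite h.
  by rewrite (proj1 (count_occ_not_In _ _ _) hw); lia.
elim: l l' => [|a l IH] l' h hl.
  by rewrite (proj1 (length_zero_iff_nil l') hl).
have ha : In a l'.
  apply/(count_occ_In disc_eq_dec); have := h a.
  by rewrite /= ; case: disc_eq_dec => // _; lia.
have [l1 [l2 e]] := in_split _ _ ha.
rewrite e in h hl *; apply: Permutation_cons_app; apply: IH.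
  move=> w; have := h w; rewrite !count_occ_app /=.
  by case: disc_eq_dec => _; lia.
by move: hl; rewrite !length_app /=; lia.
Qed.

(** * The form of the automorphisms of the disc *)

Lemma bernoulli_le (x : R) n : (0 <= x <= 1)%R -> (1 - INR n * x <= (1 - x) ^ n)%R.
Proof.
move=> hx; elim: n => [|n IH]; first by rewrite /=; lra.
have h0 : (0 <= INR n)%R by apply: pos_INR.
rewrite S_INR /=.
have := Rmult_le_compat_l (1 - x) _ _ ltac:(lra) IH.
have : (0 <= INR n * (x * x))%R by apply: Rmult_le_pos; nra.
lra.
Qed.

Lemma cis_root_of_unity m : (2 <= m)%nat ->
  exists e, Cmod e = 1%R /\ e ^ m = 1 /\ e <> 1.
Proof.
move=> hm; have hm2 : (2 <= INR m)%R by apply: (le_INR 2).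
(* As a double angle, its cosine is 1 only if the sine of PI/m vanishes. *)
exists (cis (2 * (PI / INR m))); split; first exact: Cmod_cis.
split.
  rewrite cis_pow; have -> : (INR m * (2 * (PI / INR m)) = 2 * PI)%R by field; lra.
  by rewrite /cis cos_2PI sin_2PI.
move=> e; have := f_equal fst e; rewrite /= cos_2a_sin => h.
have hPI := PI_RGT_0.
have hx : (0 < PI / INR m)%R by apply: Rdiv_lt_0_compat; lra.
have hx2 : (PI / INR m < PI)%R.
  apply: (Rmult_lt_reg_r (INR m)); first by lra.
  have -> : (PI / INR m * INR m = PI)%R by field; lra.
  nra.
have := sin_gt_0 _ hx hx2; nra.
Qed.

(* With [a = psi 0] and [m] the order of [phi] at [a], the quotient of [phi] by the
   [m]-th power of the Blaschke factor at [a] has no zeros and boundary modulus [1],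
   hence is constant; then injectivity forces [m = 1]. *)
Lemma disc_automorphism_blaschke phi psi :
  analytic_self_map phi -> cancel phi psi -> cancel psi phi ->
  exists (c : C) a, Cmod c = 1%R /\ forall z, (phi z : C) = c * blaschke_factor a z.
Proof.
move=> hphi h1 h2.
have [o ho] := disc_of 0 ltac:(rewrite Cmod_0; lra).
set a := psi o.
have pa : (phi a : C) = 0 by rewrite h2.
have pne z : z <> a -> (phi z : C) <> 0.
  move=> hz e; apply: hz; rewrite -(h1 z); congr psi; apply: disc_eq.
  by rewrite e ho.
case: (analytic_order _ a hphi) => [hn|[m [u [hu [hu0 eu]]]]].
  have [z [hz e]] := near_pick _ _ hn.
  by case: (pne z hz).
have hm : (0 < m)%nat.
  have hord : has_order (fun z => phi z : C) a m.
    by exists u; split; first exact: analytic_cont.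
  exact: has_order_gt0 hord pa.
have hune z : u z <> 0.
  case: (classic (z = a)) => [->//|hz] e; case: (pne z hz).
  by rewrite eu e; ring.
pose den z := 1 - Cconj a * z.
have hden z : den z <> 0 := blaschke_den_ne0 a z.
(* This is the quotient of [phi] by the m-th power of the Blaschke factor, with [(z - a) ^ m]
   already cancelled. *)
pose q z := u z * (- den z) ^ m.
have eq z : (phi z : C) = q z * blaschke_factor a z ^ m.
  rewrite eu /q -[RHS]Cmult_assoc [X in _ = u z * X](_ : _ = (z - a) ^ m); first by ring.
  rewrite -Cpow_mult_l; congr (_ ^ _).
  by rewrite /blaschke_factor -/(den z); field.
have hq : analytic q.
  apply: analytic_mult => //; apply: analytic_pow.
  apply: (analytic_ext (fun z => -(1) * den z)); first by move=> z; ring.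
  exact: analytic_scal (analytic_blaschke_den a).
have hq0 z : q z <> 0.
  by apply: Cmult_neq_0 => //; apply/Cpow_nz/Copp_neq_0/hden.
have [c [hc ec]] : exists c, Cmod c = 1%R /\ forall z, q z = c.
  apply: boundary_unimodular => // eps he.
  (* Chosen so that [(1 + eps) * (1 - m eta) > 1]: by Bernoulli [b ^ m] is at least [1 - m eta], and
     [Q * b ^ m < 1] then gives [Q < 1 + eps]. *)
  set eta := (eps / ((1 + eps) * (INR m + 1)))%R.
  have hmp : (0 <= INR m)%R by apply: pos_INR.
  have hetap : (0 < eta)%R.
    by apply: Rdiv_lt_0_compat => //; apply: Rmult_lt_0_compat; lra.
  have heta : ((1 + eps) * (INR m + 1) * eta = eps)%R.
    by rewrite /eta; field; split; lra.
  have hb : forall y, disc_cont_at (blaschke_map a) y.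
    by move=> y; apply: analytic_cont; exact: (analytic_blaschke a).
  have [r1 [hr1 k1]] := proper_of_inverse_cont phi psi h1
    (inverse_cont phi psi hphi h1 h2) eps he.
  have [r2 [hr2 k2]] := proper_of_inverse_cont (blaschke_map a) (blaschke_map a)
    (blaschke_map_involutive a) hb eta hetap.
  exists (Rmax r1 r2); split; first exact: Rmax_lub_lt.
  move=> z hz; have l1 := Rmax_l r1 r2; have l2 := Rmax_r r1 r2.
  have {}k1 := k1 z ltac:(lra); have {}k2 := k2 z ltac:(lra).
  have e := f_equal Cmod (eq z); rewrite Cmod_mult Cmod_pow in e.
  have b1 := blaschke_lt1 a z; have b0 := Cmod_ge_0 (blaschke_factor a z).
  rewrite /= in k2; set b := Cmod (blaschke_factor a z) in e b1 b0 k2.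
  have hqp := Cmod_ge_0 (q z); set Q := Cmod (q z) in e hqp *.
  have hb1 : (b ^ m <= 1)%R by have := pow_incr b 1 m ltac:(lra); rewrite pow1.
  rewrite e in k1; split.
    have := Rmult_le_compat_l _ _ _ hqp hb1; lra.
  have hme : (0 <= INR m * eta)%R by nra.
  have heta1 : (eta <= 1)%R.
    apply: (Rmult_le_reg_l (1 + eps)); first by lra.
    have : (0 <= (1 + eps) * (INR m * eta))%R by nra.
    lra.
  have hB := bernoulli_le eta m ltac:(lra).
  have hB2 : ((1 - eta) ^ m <= b ^ m)%R by apply: pow_incr; lra.
  have hlt := disc_lt1 (phi z); rewrite e in hlt.
  have h3 : (Q * (1 - INR m * eta) < 1)%R.
    have := Rmult_le_compat_l _ _ _ hqp (Rle_trans _ _ _ hB hB2); lra.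
  have h4 : (1 < (1 + eps) * (1 - INR m * eta))%R by nra.
  apply: Rnot_le_lt => hge.
  have hpos : (0 < 1 - INR m * eta)%R by nra.
  have := Rmult_le_compat_r _ _ _ (Rlt_le _ _ hpos) hge; lra.
exists c, a; split=> // z.
rewrite eq ec; have -> : m = 1%nat; last by rewrite Cpow_1_r.
case: (le_lt_dec 2 m) => hm2; last by lia.
have [e [he1 [hem hne]]] := cis_root_of_unity m hm2.
have hhalf : Cmod (RtoC (/ 2)) = (/ 2)%R by apply: Cmod_Rpos; lra.
have [x hx] := disc_of (RtoC (/ 2)) ltac:(rewrite hhalf; lra).
have [y hy] := disc_of (e * RtoC (/ 2)) ltac:(rewrite Cmod_mult he1 hhalf; lra).
(* If m is at least 2, this injective map takes the same value at 1/2 and e/2. *)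
have val (t : unit_disc) : (phi (blaschke_map a t) : C) = c * t ^ m.
  rewrite eq ec; congr (_ * _ ^ _).
  exact: (f_equal disc_val (blaschke_map_involutive a t)).
have exy : x = y.
  apply: (can_inj (blaschke_map_involutive a)); apply: (can_inj h1); apply: disc_eq.
  by rewrite !val hx hy Cpow_mult_l hem; ring.
case: hne; apply: (Cmult_reg_l (RtoC (/ 2))).
  by apply: Cmod_ne0; rewrite hhalf; lra.
by rewrite Cmult_comm -hy -exy hx; ring.
Qed.

(** Invariance of the pseudo-hyperbolic distance, with its phase. The explicit k is unimodular
    because its numerator and denominator are conjugate. *)
Lemma blaschke_factor_comp phi (c : C) a x z :
  Cmod c = 1%R -> (forall z, (phi z : C) = c * blaschke_factor a z) ->
  exists k, Cmod k = 1%R /\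
    forall z, blaschke_factor (phi x) (phi z) = k * blaschke_factor x z.
Proof.
move=> hc e.
exists (- c * ((1 - a * Cconj x) / (1 - Cconj a * x))).
have hcc : c * Cconj c = 1 by rewrite -Cmod2_conj hc /= !Rmult_1_r.
have h1 := blaschke_den_ne0 a x.
have h1' : 1 - a * Cconj x <> 0.
  move=> e0; apply: h1; rewrite -(Cconj_conj (1 - Cconj a * x)).
  rewrite Cminus_conj Cmult_conj Cconj_conj.
  have -> : Cconj 1 = 1 by rewrite /Cconj /= Ropp_0.
  by rewrite e0 /Cconj /= Ropp_0.
split.
  rewrite Cmod_mult Cmod_opp hc Rmult_1_l Cmod_div //.
  have -> : Cmod (1 - a * Cconj x) = Cmod (1 - Cconj a * x).
    rewrite -Cmod_conj Cminus_conj Cmult_conj Cconj_conj.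
    by have -> : Cconj 1 = 1 by rewrite /Cconj /= Ropp_0.
  by field; have := Cmod_pos _ h1; lra.
move=> y; have h2 := blaschke_den_ne0 a y; have h3 := blaschke_den_ne0 x y.
have h4 := blaschke_den_ne0 a a.
have h5 := blaschke_den_ne0 (phi x) (phi y).
have ec : Cconj (phi x) = Cconj c * ((Cconj a - Cconj x) / (1 - a * Cconj x)).
  rewrite e /blaschke_factor Cmult_conj Cdiv_conj // !Cminus_conj Cmult_conj Cconj_conj.
  by have -> : Cconj 1 = 1 by rewrite /Cconj /= Ropp_0.
have eden : 1 - Cconj (phi x) * phi y =
   (1 - Cconj a * a) * (1 - Cconj x * y) / ((1 - a * Cconj x) * (1 - Cconj a * y)).
  rewrite ec e /blaschke_factor.
  have -> : Cconj c * ((Cconj a - Cconj x) / (1 - a * Cconj x)) *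
    (c * ((a - y) / (1 - Cconj a * y))) = (c * Cconj c) *
    ((Cconj a - Cconj x) * (a - y) / ((1 - a * Cconj x) * (1 - Cconj a * y))).
    by field.
  by rewrite hcc; field.
rewrite {1}/blaschke_factor eden !e /blaschke_factor; field.
by repeat split.
Qed.

Lemma blaschke_prod_comp phi psi (c : C) a l :
  cancel psi phi -> Cmod c = 1%R -> (forall z, (phi z : C) = c * blaschke_factor a z) ->
  exists k, Cmod k = 1%R /\
    forall z, blaschke_prod l (phi z) = k * blaschke_prod (map psi l) z.
Proof.
move=> h2 hc e; elim: l => [|b l [k [hk IH]]].
  by exists 1; split=> [|z /=]; [exact: Cmod_1 | ring].
have [k' [hk' e']] := blaschke_factor_comp phi c a (psi b) b hc e.
exists (k' * k); split; first by rewrite Cmod_mult hk hk'; ring.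
move=> z; rewrite /= -/(blaschke_prod l (phi z)) IH.
have -> : blaschke_factor b (phi z) = blaschke_factor (phi (psi b)) (phi z) by rewrite h2.
by rewrite e' /blaschke_prod; ring.
Qed.

Lemma count_occ_map_inverse phi psi l w : cancel phi psi -> cancel psi phi ->
  count_occ disc_eq_dec (map psi l) w = count_occ disc_eq_dec l (phi w).
Proof.
move=> h1 h2; elim: l => //= b l ->.
case: disc_eq_dec => [<-|hne]; case: disc_eq_dec => // e.
  by case: e.
by case: hne; rewrite e.
Qed.

(** The Blaschke map is an involution, so psi(y) is the Blaschke factor at y/c. *)
Lemma inverse_analytic phi psi (c : C) a :
  cancel psi phi -> Cmod c = 1%R -> (forall z, (phi z : C) = c * blaschke_factor a z) ->
  analytic_self_map psi.
Proof.
move=> h2 hc e.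
have hc0 : c <> 0 by apply: Cmod_ne0; lra.
have hb y : (blaschke_map a (psi y) : C) = / c * y.
  by rewrite -[in RHS](h2 y) e /=; field.
have hd (y : unit_disc) : 1 - Cconj a * (/ c * y) <> 0.
  by rewrite -hb; exact: blaschke_den_ne0.
apply: (analytic_ext (fun y => (a - / c * y) * / (1 - Cconj a * (/ c * y)))).
  by move=> y; rewrite -hb -[in RHS](blaschke_map_involutive a (psi y)).
have hcy : analytic (fun y => / c * y) by exact: analytic_scal analytic_id.
apply: analytic_mult.
  by apply: analytic_minus => //; exact: analytic_const.
apply: analytic_inv hd _; apply: analytic_minus; first exact: analytic_const.
exact: analytic_scal.
Qed.

Theorem theorem3p3 (phi : unit_disc -> unit_disc) (B : unit_disc -> C)
    (hphi : analytic_self_map phi) (hB : finite_blaschke_product B) :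
  algebra_automorphism (BHinf B) (comp_op phi) <->
  (Aut_disc phi /\
   forall w : unit_disc, zero_set B w -> multiplicity B (phi w) = multiplicity B w).
Proof.
have [c0 [l [hc0 eB']]] := hB.
have eB z : B z = c0 * blaschke_prod l z by exact: eB'.
have hc0n : c0 <> 0 by apply: Cmod_ne0; lra.
have aB : analytic B.
  apply: (analytic_ext (fun z => c0 * blaschke_prod l z)) => [z|]; first by rewrite eB.
  exact: analytic_scal (analytic_blaschke_prod l).
have HB : Hinf B.
  split=> //; exists 1%R => z.
  by rewrite eB Cmod_mult hc0 Rmult_1_l; exact: blaschke_prod_le1.
have ordB w : has_order B w (count_occ disc_eq_dec l w).
  apply: (has_order_ext (fun z => c0 * blaschke_prod l z)) => [z|]; first by rewrite eB.
  have h0 : has_order (fun _ => c0) w 0 by apply: has_order_0 => //; exact: cont_const.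
  exact: has_order_mult h0 (has_order_blaschke_prod l w).
have multB w : multiplicity B w = count_occ disc_eq_dec l w.
  exact: multiplicity_has_order.
split.
  move=> haut.
  have [hinj hord] := automorphism_injective_orders B phi haut HB hphi
    (fun w => ex_intro _ _ (ordB w)).
  (* Two distinct points where [B] is nonzero are found, the second near the first; at most one of
     them is c. *)
  have hne (c : C) : exists z, B z <> 0 /\ (z : C) <> c.
    have [o ho] := disc_of 0 ltac:(rewrite Cmod_0; lra).
    have [x [hxo hx]] := near_pick _ _ (has_order_near _ _ _ (ordB o)).
    have hx0 := hx hxo.
    have [y [hyx hy]] := near_pick _ _ (cont_nonzero _ _ (analytic_cont B x aB) hx0).
    case: (classic ((x : C) = c)) => hxc; last by exists x.
    exists y; split; last by move=> hyc; apply: hyx; apply: disc_eq; rewrite hyc hxc.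
    by apply: Cmod_ne0; have := Cmod_pos _ hx0; lra.
  have hsurj := automorphism_surjective B phi haut HB hphi hne.
  split; last by move=> w _; rewrite (multB w); apply: multiplicity_has_order => //; exact: hord.
  split=> //.
  pose psi w := proj1_sig (constructive_indefinite_description _ (hsurj w)).
  have hpsi : cancel psi phi.
    by move=> w; rewrite /psi; case: constructive_indefinite_description.
  by exists psi => // z; apply: hinj; rewrite hpsi.
move=> [[_ [psi h1 h2]] hmult].
have [c [a [hc e]]] := disc_automorphism_blaschke phi psi hphi h1 h2.
have hpsi := inverse_analytic phi psi c a h2 hc e.
(* The count of w in [map psi l] is that of [phi w] in l, that is the multiplicity at [phi w]. The
   hypothesis covers only zeros of [B], hence only w in l; the equal lengths supply the rest. *)
have hperm : Permutation l (map psi l).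
  apply: count_occ_permutation; last by rewrite length_map.
  move=> w hw; rewrite (count_occ_map_inverse phi) // -!multB; apply: hmult.
  apply: has_order_zero (ordB w) _.
  exact: (proj1 (count_occ_In disc_eq_dec l w)).
have [k [hk ek]] := blaschke_prod_comp phi psi c a l h2 hc e.
have hk0 : k <> 0 by apply: Cmod_ne0; lra.
have Bphi z : B (phi z) = k * B z.
  by rewrite !eB ek (blaschke_prod_permutation _ _ z hperm); ring.
have Bpsi z : B (psi z) = / k * B z.
  by rewrite -[in RHS](h2 z) Bphi; field.
split.
  move=> F [f [hf ->]]; rewrite /comp_op.
  apply: (BHinf_ext _ (fun z => B z * (k * f (phi z)))).
    by move=> z; rewrite Bphi; ring.
  exact: BHinf_intro (Hinf_scal _ _ (Hinf_comp _ _ hf hphi)).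
do 3!split=> //.
split.
  move=> f g _ _ efg; apply: functional_extensionality => z.
  by have := f_equal (fun F => F (psi z)) efg; rewrite /comp_op h2.
move=> F [f [hf ->]].
exists (fun z => B (psi z) * f (psi z)); split.
  apply: (BHinf_ext _ (fun z => B z * (/ k * f (psi z)))).
    by move=> z; rewrite Bpsi; ring.
  exact: BHinf_intro (Hinf_scal _ _ (Hinf_comp _ _ hf hpsi)).
by apply: functional_extensionality => z; rewrite /comp_op h1.
Qed.
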